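(* Let $m,p,n\geq1$, $T>0$, and let $\mathcal{X}_1,\dots,\mathcal{X}_n\in\mathbb{C}^{m\times m\times p}$ be independent random Hermitian T-product tensors such that almost surely $\mathcal{X}_i\succeq\mathcal{O}$ and $\lambda_{\max}(\mathcal{X}_i)\leq T$. Define $\mu_{\max}=\lambda_{\max}\left(\sum_{i=1}^n\mathbb{E}\mathcal{X}_i\right)$ and $\mu_{\min}=\lambda_{\min}\left(\sum_{i=1}^n\mathbb{E}\mathcal{X}_i\right)$. Then $$\Pr\left(\lambda_{\max}\left(\sum_{i=1}^n\mathcal{X}_i\right)\geq(1+\theta)\mu_{\max}\right)\leq mp\left(\frac{e^{\theta}}{(1+\theta)^{1+\theta}}\right)^{\mu_{\max}/T}\quad\text{for }\theta\geq0,$$ and $$\Pr\left(\lambda_{\min}\left(\sum_{i=1}^n\mathcal{X}_i\right)\leq(1-\theta)\mu_{\min}\right)\leq mp\left(\frac{e^{-\theta}}{(1-\theta)^{1-\theta}}\right)^{\mu_{\min}/T}\quad\text{for }\theta\in[0,1].$$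
   Context: For $\mathcal{A}\in\mathbb{C}^{m\times n\times p}$ with frontal slices $A^{(1)},\dots,A^{(p)}$, $\mathrm{bcirc}(\mathcal{A})\in\mathbb{C}^{mp\times np}$ is the block circulant matrix whose $(r,s)$ block is $A^{(((r-s)\bmod p)+1)}$. The conjugate transpose $\mathcal{A}^{\mathrm H}$ is obtained by conjugate-transposing every frontal slice and reversing the order of slices $2,\dots,p$, so $\mathrm{bcirc}(\mathcal{A}^{\mathrm H})=\mathrm{bcirc}(\mathcal{A})^{\mathrm H}$. $\mathcal{A}\in\mathbb{C}^{m\times m\times p}$ is Hermitian if $\mathcal{A}^{\mathrm H}=\mathcal{A}$; its eigenvalues are the $mp$ eigenvalues of $\mathrm{bcirc}(\mathcal{A})$, with largest/smallest $\lambda_{\max}$/$\lambda_{\min}$. For Hermitian $\mathcal{A},\mathcal{B}$, $\mathcal{A}\preceq\mathcal{B}$ means $\mathrm{bcirc}(\mathcal{B}-\mathcal{A})$ is positive semidefinite; $\mathcal{O}$ is the zero tensor. Expectation is entrywise; $0^0=1$. *)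

(* Defs.v *)
From HB Require Import structures.
From mathcomp Require Import all_boot all_order all_algebra.
From mathcomp Require Import all_classical all_reals all_analysis.
From mathcomp Require Import complex.

Set Implicit Arguments.
Unset Strict Implicit.
Unset Printing Implicit Defensive.

Import Order.TTheory GRing.Theory Num.Theory.
Local Open Scope ring_scope.
Local Open Scope classical_set_scope.

(* Third-order tensors  A in C^{m x n x p}, stored by frontal slices.  *)
(* Slice number k : 'I_p (0-based) is A^{(k+1)} of the paper.          *)
Definition tensor (R : rcfType) (m n p : nat) := {ffun 'I_p -> 'M[R[i]]_(m, n)}.

Lemma ord_pos (p : nat) (r : 'I_p) : (0 < p)%N.
Proof. exact: leq_ltn_trans (leq0n r) (ltn_ord r). Qed.

(* ((r - s) mod p) as an element of 'I_p (0-based version of the   *)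
(* paper's index ((r-s) mod p) + 1).                                 *)
Definition circ_idx (p : nat) (r s : 'I_p) : 'I_p :=
  Ordinal (ltn_pmod (r + p - s) (ord_pos r)).

Definition ctrmx (R : rcfType) (m n : nat) (M : 'M[R[i]]_(m, n)) : 'M[R[i]]_(n, m) :=
  \matrix_(i, j) conjc (M j i).

Definition bcirc (R : rcfType) (m n p : nat) (A : tensor R m n p) :=
  @mxblock _ p p (fun _ => m) (fun _ => n) (fun r s => A (circ_idx r s)).

(* conjugate transpose of a tensor: conjugate-transpose every slice and *)
(* reverse the order of slices 2..p, i.e. (A^H)^{(k)} = (A^{(1 - k mod p)})^H *)
Definition tH (R : rcfType) (m n p : nat) (A : tensor R m n p) : tensor R n m p :=
  [ffun k : 'I_p => ctrmx (A (circ_idx (Ordinal (ord_pos k)) k))].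

Definition hermitian_tensor (R : rcfType) (m p : nat) (A : tensor R m m p) : Prop :=
  tH A = A.

Definition psd_mx (R : rcfType) (N : nat) (M : 'M[R[i]]_N) : Prop :=
  ctrmx M = M /\ forall v : 'cV[R[i]]_N, 0 <= (ctrmx v *m M *m v) 0 0.

Definition tle (R : rcfType) (m p : nat) (A B : tensor R m m p) : Prop :=
  psd_mx (bcirc (B - A)).

(* eigenvalues of a Hermitian tensor are the eigenvalues of bcirc(A) (all real) *)
Definition tlmax (R : realType) (m p : nat) (A : tensor R m m p) : R :=
  sup [set t : R | eigenvalue (bcirc A) (real_complex R t)].
Definition tlmin (R : realType) (m p : nat) (A : tensor R m m p) : R :=
  inf [set t : R | eigenvalue (bcirc A) (real_complex R t)].

Section RandomTensors.
Context {d : measure_display} {Omega : measurableType d} {R : realType}.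
Variable P : probability Omega R.

Definition cexpect (f : Omega -> R[i]) : R[i] :=
  (fine ('E_P[fun w => complex.Re (f w)]) +i* fine ('E_P[fun w => complex.Im (f w)]))%C.

Definition texpect (m n p : nat) (X : Omega -> tensor R m n p) : tensor R m n p :=
  [ffun k => \matrix_(a, b) cexpect (fun w => X w k a b)].

Definition random_tensor (m n p : nat) (X : Omega -> tensor R m n p) : Prop :=
  forall k a b, measurable_fun setT (fun w => complex.Re (X w k a b)) /\
                measurable_fun setT (fun w => complex.Im (X w k a b)).

Definition tensor_gen (m n p : nat) (X : Omega -> tensor R m n p) : set_system Omega :=
  [set A | exists k a b (B : set R), measurable B /\
     (A = (fun w => complex.Re (X w k a b)) @^-1` B \/ A = (fun w => complex.Im (X w k a b)) @^-1` B)].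

Definition tensor_sigma (m n p : nat) (X : Omega -> tensor R m n p) : set_system Omega :=
  <<s setT, tensor_gen X >>.

(* mutual independence of random tensors X_0, ..., X_{N-1}: the product rule *)
(* for events from the generated sigma-algebras (taking A i = setT for the   *)
(* indices outside a subfamily gives the product rule for every subfamily).  *)
Definition tindependent (N m n p : nat) (X : 'I_N -> Omega -> tensor R m n p) : Prop :=
  forall A : 'I_N -> set Omega, (forall i, tensor_sigma (X i) (A i)) ->
    P (\big[setI/setT]_(i < N) A i) = (\prod_(i < N) P (A i))%E.

End RandomTensors.

(* Main.v *)
(* Let [bcirc X_i = Y_i]: these are independent random Hermitian matrices with
   spectrum in [0, T], and the claim is the matrix Chernoff bound for their sum.
   No concavity theorem of Lieb type is needed, because the final bound only
   involves the linear majorant of [exp (s x)] on [0, T]. The heart is the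
   deterministic inequality, for Hermitian A and 0 <= X <= T,

     T (tr e^(A + sX) - tr e^A) <= (e^(sT) - 1) tr (e^A X).

   With c T = e^(sT) - 1 it yields, conditionally on the other summands,

     E tr e^(A + sX) <= tr e^A + c tr (e^A E X) <= tr e^(A + c E X),

   the last step being Klein's inequality. Replacing the summands one at a time
   gives E tr exp (s sum X_i) <= tr exp (c sum E X_i), and the Laplace transform
   method concludes.

   The deterministic inequality is obtained by cutting [0, s] into n steps of
   length h. Writing all the traces in eigenbases of two consecutive matrices A
   and B = A + hX, as tr f(A) g(B) = sum_ij w_ij f(a_i) g(b_j) with w_ij >= 0,
   reduces matters to scalar inequalities: (e^b - e^a) (b - a) is at most
   (b - a)^2 (e^a + e^b) / 2, and X^2 <= T X, so tr (e^A X) grows in one step by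
   a factor of at most (1 + hT/2) / (1 - hT/2). Now let n tend to infinity.

   Measurability of the largest eigenvalue comes from writing it as the limit
   of (1/k) ln tr e^(kA), and that of e^A from its power series. *)
Require Import Defs.
From HB Require Import structures.
From mathcomp Require Import all_boot all_order all_algebra.
From mathcomp Require Import all_classical all_reals all_analysis.
From mathcomp Require Import complex measurable_realfun ring lra zify.
Import Order.TTheory GRing.Theory Num.Theory.
Import numFieldNormedType.Exports.
Local Open Scope ring_scope.
Local Open Scope classical_set_scope.
Set Implicit Arguments.
Unset Strict Implicit.
Unset Printing Implicit Defensive.

(** * Spectral calculus for Hermitian matrices *)

Section Spectral.
Context {R : realType}.
Local Notation C := R[i].
Local Notation "x %:C" := (real_complex R x).
Local Notation Re := (@complex.Re R).
Local Notation Im := (@complex.Im R).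

Lemma ReD (x y : C) : Re (x + y) = Re x + Re y.
Proof. by case: x; case: y. Qed.
Lemma ReN (x : C) : Re (- x) = - Re x.
Proof. by case: x. Qed.
Lemma ReB (x y : C) : Re (x - y) = Re x - Re y.
Proof. by rewrite ReD ReN. Qed.
Lemma ReZ (a : R) (x : C) : Re (a%:C * x) = a * Re x.
Proof. by case: x => u v /=; rewrite mul0r subr0. Qed.
Lemma ImD (x y : C) : Im (x + y) = Im x + Im y.
Proof. by case: x; case: y. Qed.
Lemma ImZ (a : R) (x : C) : Im (a%:C * x) = a * Im x.
Proof. by case: x => u v /=; rewrite mul0r addr0. Qed.
Lemma Re_sum (I : Type) (r : seq I) (Q : pred I) (F : I -> C) :
  Re (\sum_(i <- r | Q i) F i) = \sum_(i <- r | Q i) Re (F i).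
Proof. exact: (big_morph Re ReD erefl). Qed.
Lemma Im_sum (I : Type) (r : seq I) (Q : pred I) (F : I -> C) :
  Im (\sum_(i <- r | Q i) F i) = \sum_(i <- r | Q i) Im (F i).
Proof. exact: (big_morph Im ImD erefl). Qed.

Variable N : nat.
Implicit Types A B M : 'M[C]_N.

Definition hermmx A := ctrmx A = A.

Lemma ctrmxE m n (M : 'M[C]_(m, n)) : ctrmx M = (M^t*)%sesqui.
Proof. by apply/matrixP => i j; rewrite !mxE. Qed.

Lemma ctrmxK m n (M : 'M[C]_(m, n)) : ctrmx (ctrmx M) = M.
Proof. by apply/matrixP => i j; rewrite !mxE conjcK. Qed.
Lemma ctrmxD m n (A B : 'M[C]_(m, n)) : ctrmx (A + B) = ctrmx A + ctrmx B.
Proof. by apply/matrixP => i j; rewrite !mxE rmorphD. Qed.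
Lemma ctrmxZ m n (a : R) (A : 'M[C]_(m, n)) :
  ctrmx (a%:C *: A) = a%:C *: ctrmx A.
Proof. by apply/matrixP => i j; rewrite !mxE rmorphM /= oppr0. Qed.
Lemma ctrmxM m n k (A : 'M[C]_(m, n)) (B : 'M[C]_(n, k)) :
  ctrmx (A *m B) = ctrmx B *m ctrmx A.
Proof. by rewrite !ctrmxE trmx_mul map_mxM. Qed.

Lemma hermmxD A B : hermmx A -> hermmx B -> hermmx (A + B).
Proof. by rewrite /hermmx ctrmxD => -> ->. Qed.
Lemma hermmxZ (a : R) A : hermmx A -> hermmx (a%:C *: A).
Proof. by rewrite /hermmx ctrmxZ => ->. Qed.
Lemma hermmx0 : hermmx 0.
Proof. by apply/matrixP => i j; rewrite !mxE conjc0. Qed.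
Lemma hermmx_sum (I : Type) (r : seq I) (Q : pred I) (F : I -> 'M[C]_N) :
  (forall i, hermmx (F i)) -> hermmx (\sum_(i <- r | Q i) F i).
Proof.
move=> h; elim/big_rec: _ => [|i x _]; first exact: hermmx0.
exact: hermmxD.
Qed.

(* The rows of [eigmx A] form an orthonormal eigenbasis when [A] is normal. The
   definitions are locked because unification otherwise unfolds matrix products
   down to their entries. *)
Definition eigmx A : 'M[C]_N := locked (spectralmx A).
Definition eigv A (j : 'I_N) : R := locked (Re (spectral_diag A 0 j)).

(** For Hermitian [A] this is f(A) in the functional calculus. The eigenvectors being rows, the
    adjoint stands on the left. For other [A] it is still a function of one unitary basis, so
    multiplicativity in f holds without hypothesis. *)
Definition funmx (f : R -> R) A : 'M[C]_N :=
  locked (ctrmx (eigmx A) *m diag_mx (\row_j (f (eigv A j))%:C) *m eigmx A).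

Lemma funmxE f A : funmx f A =
  ctrmx (eigmx A) *m diag_mx (\row_j (f (eigv A j))%:C) *m eigmx A.
Proof. by rewrite /funmx -lock. Qed.

Lemma eigmxKV A : eigmx A *m ctrmx (eigmx A) = 1%:M.
Proof. by rewrite ctrmxE /eigmx -lock; apply/unitarymxP/spectral_unitarymx. Qed.

Lemma eigmxVK A : ctrmx (eigmx A) *m eigmx A = 1%:M.
Proof. exact/mulmx1C/eigmxKV. Qed.

Lemma funmx_id A : hermmx A -> funmx id A = A.
Proof.
move=> hA.
have hs : A \is hermsymmx.
  by apply/is_hermitianmxP; rewrite expr0 scale1r -ctrmxE hA.
have /orthomx_spectralP eA := hermitian_normalmx hs.
have /mxOverP re := hermitian_spectral_diag_real hs.
rewrite invmx_unitary ?spectral_unitarymx// in eA.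
(* The eigenvalues of a Hermitian matrix are real, so nothing is lost by the real part in [eigv]. *)
have e : spectral_diag A = \row_j (eigv A j)%:C.
  apply/rowP => j; rewrite mxE /eigv -lock.
  have /RRe_real h := re 0 j.
  by rewrite h.
rewrite funmxE -e ctrmxE /eigmx -lock.
by symmetry.
Qed.

Lemma conj_diagM (U V F G : 'M[C]_N) : U *m V = 1%:M ->
  V *m F *m U *m (V *m G *m U) = V *m (F *m G) *m U.
Proof. by move=> UV; rewrite !mulmxA -(mulmxA (V *m F) U V) UV mulmx1. Qed.

Lemma mxtrace_conj (U U' V V' F G : 'M[C]_N) :
  \tr (U' *m F *m U *m (V' *m G *m V)) = \tr (F *m (U *m V' *m G *m (V *m U'))).
Proof. by rewrite -!mulmxA [LHS]mxtrace_mulC -!mulmxA. Qed.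

Lemma funmxM f g A : funmx f A *m funmx g A = funmx (fun x => f x * g x) A.
Proof.
rewrite !funmxE (conj_diagM _ _ (eigmxKV A)) mulmx_diag.
set u := (\row_j _ in LHS); set v := (\row_j _ in RHS).
suff -> : u = v by [].
by apply/rowP => j; rewrite !mxE rmorphM.
Qed.

Lemma funmxMid f A : hermmx A -> funmx f A *m A = funmx (fun x => f x * x) A.
Proof. by move=> hA; rewrite -[X in _ *m X](funmx_id hA) funmxM. Qed.

Lemma funmxMidl f A : hermmx A -> A *m funmx f A = funmx (fun x => x * f x) A.
Proof. by move=> hA; rewrite -[X in X *m _](funmx_id hA) funmxM. Qed.

Lemma funmx1 A : funmx (fun=> 1) A = 1%:M.
Proof.
rewrite funmxE (_ : diag_mx _ = 1%:M) ?mulmx1 ?eigmxVK//.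
by apply/matrixP => i j; rewrite !mxE.
Qed.

(** For one Hermitian matrix or a product of two the trace is already real; [Re] places it in [R],
    where it can be compared. *)
Definition rtr M : R := Re (\tr M).

Lemma rtrB A B : rtr (A - B) = rtr A - rtr B.
Proof. by rewrite /rtr raddfB ReB. Qed.
Lemma rtrZ (a : R) A : rtr (a%:C *: A) = a * rtr A.
Proof. by rewrite /rtr mxtraceZ ReZ. Qed.
Lemma rtrMB M A B : rtr (M *m (A - B)) = rtr (M *m A) - rtr (M *m B).
Proof. by rewrite mulmxBr rtrB. Qed.
Lemma rtrMZ M (a : R) A : rtr (M *m (a%:C *: A)) = a * rtr (M *m A).
Proof. by rewrite -scalemxAr rtrZ. Qed.
Lemma rtrM_sqrB M A B : rtr (M *m ((B - A) *m (B - A))) =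
  rtr (M *m (B *m B)) - rtr (M *m (B *m A)) -
  (rtr (M *m (A *m B)) - rtr (M *m (A *m A))).
Proof. by rewrite mulmxBl rtrMB (mulmxBr B) rtrMB (mulmxBr A) rtrMB opprB. Qed.
Lemma rtrM_sqrZ M (a : R) A :
  rtr (M *m ((a%:C *: A) *m (a%:C *: A))) = a * (a * rtr (M *m (A *m A))).
Proof. by rewrite -scalemxAl rtrMZ -(scalemxAr _ A A) rtrMZ. Qed.
Lemma rtrC A B : rtr (A *m B) = rtr (B *m A).
Proof. by rewrite /rtr mxtrace_mulC. Qed.

(** The squared modulus of the inner product of the i-th eigenvector of [A] with the j-th of [B]:
    the nonnegative weight of the pair of eigenvalues in a mixed trace. *)
Definition overlap A B (i j : 'I_N) : R :=
  let z := (eigmx A *m ctrmx (eigmx B)) i j in Re z ^+ 2 + Im z ^+ 2.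

Lemma overlap_ge0 A B i j : 0 <= overlap A B i j.
Proof. by rewrite addr_ge0 ?sqr_ge0. Qed.

Lemma rtr_funmxM f g A B : rtr (funmx f A *m funmx g B) =
  \sum_i \sum_j overlap A B i j * (f (eigv A i) * g (eigv B j)).
Proof.
rewrite /rtr !funmxE mxtrace_conj.
have -> : eigmx B *m ctrmx (eigmx A) = ctrmx (eigmx A *m ctrmx (eigmx B)).
  by rewrite ctrmxM ctrmxK.
rewrite /overlap; move: (eigmx A *m ctrmx (eigmx B)) => Z.
rewrite mul_diag_mx /mxtrace Re_sum; apply: eq_bigr => i _.
rewrite mxE mxE ReZ mxE Re_sum mulr_sumr; apply: eq_bigr => j _.
rewrite mul_mx_diag !mxE.
case: (Z i j) => a b /=.
by ring.
Qed.

Lemma rtr_funmx f A : rtr (funmx f A) = \sum_j f (eigv A j).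
Proof.
rewrite /rtr !funmxE mxtrace_mulC mulmxA eigmxKV mul1mx mxtrace_diag Re_sum.
by apply: eq_bigr => j _; rewrite mxE.
Qed.

Definition mexp := funmx expR.

(** Inserting the identity as a constant function of [A] spreads a single trace over the same double
    sum as a mixed one, so that trace inequalities can be checked term by term. *)
Lemma rtr_funmx2 g A B :
  rtr (funmx g B) = \sum_i \sum_j overlap A B i j * (1 * g (eigv B j)).
Proof. by rewrite -(rtr_funmxM (fun=> 1)) funmx1 mul1mx. Qed.

Lemma rtr_funmx1 f A B :
  rtr (funmx f A) = \sum_i \sum_j overlap A B i j * (f (eigv A i) * 1).
Proof. by rewrite -(rtr_funmxM _ (fun=> 1)) funmx1 mulmx1. Qed.

Lemma rtr_funmxMl f A B : hermmx B -> rtr (funmx f A *m B) =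
  \sum_i \sum_j overlap A B i j * (f (eigv A i) * eigv B j).
Proof. by move=> hB; rewrite -{1}(funmx_id hB) rtr_funmxM. Qed.

Lemma expR_tangent (a b : R) : expR a + expR a * (b - a) <= expR b.
Proof.
have -> : expR b = expR a * expR (b - a) by rewrite -expRD; congr expR; ring.
rewrite -[X in X + _]mulr1 -mulrDr ler_wpM2l ?expR_ge0 ?expR_ge1Dx//.
Qed.

(** Convexity of exp: its tangent at each eigenvalue of [A] lies below its value at each eigenvalue
    of [B], and the overlaps are nonnegative weights. *)
Lemma klein A B : hermmx A -> hermmx B ->
  rtr (mexp A) + rtr (mexp A *m (B - A)) <= rtr (mexp B).
Proof.
move=> hA hB; rewrite mulmxBr rtrB rtr_funmxMl//.
rewrite funmxMid// (rtr_funmx1 _ A B) (rtr_funmx2 _ A B) (rtr_funmx1 _ A B).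
rewrite -sumrB -big_split /= -subr_ge0 -sumrB sumr_ge0// => i _.
rewrite -sumrB -big_split /= -sumrB sumr_ge0// => j _.
have := expR_tangent (eigv A i) (eigv B j); have := overlap_ge0 A B i j.
set w := overlap _ _ _ _ => w0 h; rewrite -!mulrBr -mulrDr -!mulrBr mulr_ge0//; lra.
Qed.

End Spectral.

(** * The shift inequality *)

(** The function k = x (e^x + 1) - 2 e^x starts at -2 and has derivative 1 + (x - 1) e^x, which is
    nonnegative because 1 - x <= e^(-x). *)
Lemma expR_trapezoid_ge0 {R : realType} (d : R) : 0 <= d ->
  expR d - 1 <= d * (expR d + 1) / 2.
Proof.
move=> d0; pose k (x : R) := x * (expR x + 1) - 2 * expR x.
have dk (x : R) : is_derive x 1 k (1 + (x - 1) * expR x).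
  apply: is_derive_eq; rewrite /GRing.scale /=; ring.
suff : k 0 <= k d by rewrite /k mul0r expR0; lra.
apply: (@ger0_derive1_le_cc _ k 0 d) => //.
- move=> x _; rewrite derive1E derive_val.
  have h : 1 - x <= expR (- x) by have := expR_ge1Dx (- x); lra.
  have := ler_wpM2r (expR_ge0 x) h; rewrite -expRD addNr expR0; lra.
- by apply: derivable_within_continuous => x _.
- by rewrite in_itv /= lexx.
- by rewrite in_itv /= lexx d0.
Qed.

(** The trapezoid rule overestimates the integral of the convex function exp. The extra factor b - a
    makes both sides symmetric, so no order between a and b is required. *)
Lemma expR_trapezoid {R : realType} (a b : R) :
  (expR b - expR a) * (b - a) <= 2^-1 * (b - a) ^+ 2 * (expR a + expR b).
Proof.
wlog ab : a b / a <= b.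
  move=> h; have [/h//|/ltW/h] := leP a b.
  rewrite (_ : (b - a) ^+ 2 = (a - b) ^+ 2); [lra|by ring].
have d0 : 0 <= b - a by rewrite subr_ge0.
have /(ler_wpM2r d0)/(ler_wpM2l (expR_ge0 a)) := expR_trapezoid_ge0 d0.
have -> : expR b = expR a * expR (b - a) by rewrite -expRD; congr expR; ring.
move=> h; apply: le_trans (le_trans h _); rewrite le_eqVlt; apply/orP; left;
  by apply/eqP; field.
Qed.

(** * Scalar recursion behind the subdivision of the shift *)

Section ScalarRecursion.
Variables (R : realType) (T s x : R) (F G : nat -> R).
Local Notation rho := ((1 + x) / (1 - x)).
Hypotheses (T0 : 0 <= T) (sT : s * T = 2 * x) (x1 : x < 1) (x_1 : -1 < x).
Hypothesis stepG : forall n, s * G n.+1 * (1 - x) <= s * G n * (1 + x).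
Hypothesis stepF : forall n, F n.+1 - F n <= s * G n.+1.

(** Here [F n] stands for tr e^(A_n), [G n] for tr (e^(A_n) X) and [s] for the step length. [s * G]
    grows at most geometrically, so the increments of [F] add up to a geometric sum, put in closed
    form by sT = 2x and rho - 1 = 2x / (1 - x). The factor [s] is never cancelled, since it may be
    negative. *)
Lemma geometric_recursion n : s * G n <= rho ^+ n * (s * G 0) /\
  T * (F n - F 0) <= G 0 * (1 + x) * (rho ^+ n - 1).
Proof.
move: T0 sT x1 x_1 => T0' sT' x1' x_1'.
have rho0 : 0 < rho by apply: divr_gt0; lra.
elim: n => [|n [IH1 IH2]]; first by rewrite expr0 mul1r !subrr !mulr0.
have h1 : s * G n.+1 <= rho * (s * G n).
  by rewrite mulrAC ler_pdivlMr ?subr_gt0//; have := stepG n; lra.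
have h2 : s * G n.+1 <= rho ^+ n.+1 * (s * G 0).
  apply: le_trans h1 _; rewrite exprS -(mulrA rho); apply: ler_wpM2l => //; exact: ltW.
split => //.
have := ler_wpM2l T0 (stepF n); have := ler_wpM2l T0 h2.
have -> : T * (rho ^+ n.+1 * (s * G 0)) = G 0 * (1 + x) * (rho ^+ n.+1 - rho ^+ n).
  have -> : T * (rho ^+ n.+1 * (s * G 0)) = s * T * rho ^+ n.+1 * G 0 by ring.
  rewrite sT exprS; move: (rho ^+ n) => r; field; lra.
lra.
Qed.

Lemma geometric_recursion_expR n : 0 <= G 0 ->
  T * (F n - F 0) <= G 0 * (1 + x) * (expR (n%:R * (2 * x / (1 - x))) - 1).
Proof.
move: x1 x_1 => x1' x_1' G0; have [_ /le_trans] := geometric_recursion n; apply.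
have rho0 : 0 < rho by apply: divr_gt0; lra.
apply: ler_wpM2l; first by rewrite mulr_ge0//; lra.
rewrite lerD2r expRM_natl lerXn2r ?nnegrE ?expR_ge0 ?(ltW rho0)//.
suff -> : rho = 1 + 2 * x / (1 - x) by exact: expR_ge1Dx.
by field; lra.
Qed.

End ScalarRecursion.

Lemma cvg_refine_step {R : realType} (t : R) :
  (t * n.+1%:R^-1 / 2) @[n --> \oo] --> (0 : R).
Proof.
have -> : 0 = t * 0 / 2 :> R by rewrite mulr0 mul0r.
by apply: cvgMl; apply: cvgMr; exact: cvg_harmonic.
Qed.

(** As the subdivision is refined, the half step t / (2 (n + 1)) tends to 0 and both of its
    corrections disappear by continuity. *)
Lemma expR_refine_limit {R : realType} (D g t : R) :
  (\forall n \near \oo, D <= g * (1 + t * n.+1%:R^-1 / 2) *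
     (expR (t / (1 - t * n.+1%:R^-1 / 2)) - 1)) ->
  D <= g * (expR t - 1).
Proof.
apply: cvgr_to_ge.
have h := cvg_refine_step t.
have -> : g * (expR t - 1) = g * (1 + 0) * (expR (t / (1 - 0)) - 1).
  by rewrite addr0 mulr1 subr0 divr1.
apply: cvgM.
  by apply: cvgMr; apply: cvgD => //; exact: cvg_cst.
apply: cvgB; last exact: cvg_cst.
apply: continuous_cvg; first exact: continuous_expR.
apply: cvgMr; apply: cvgV; first by rewrite subr0 oner_eq0.
by apply: cvgB => //; exact: cvg_cst.
Qed.

(** * Trace inequalities along one step, and their iteration *)

Section Step.
Context {R : realType} {N : nat}.
Local Notation C := R[i].
Local Notation "x %:C" := (real_complex R x).
Local Notation Re := (@complex.Re R).
Local Notation Im := (@complex.Im R).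
Implicit Types A B X : 'M[C]_N.

Lemma overlapC A B i j : overlap A B i j = overlap B A j i.
Proof.
rewrite /overlap.
have -> : eigmx B *m ctrmx (eigmx A) = ctrmx (eigmx A *m ctrmx (eigmx B)).
  by rewrite ctrmxM ctrmxK.
move: (_ *m _) => Z; rewrite mxE.
by case: (Z i j) => x y /=; rewrite sqrrN.
Qed.

Lemma rtr_funmxM_subl f A B : hermmx A -> hermmx B ->
  rtr (funmx f A *m (B - A)) =
  \sum_i \sum_j overlap A B i j * (f (eigv A i) * (eigv B j - eigv A i)).
Proof.
move=> hA hB; rewrite rtrMB (funmxMid _ hA) (rtr_funmxMl _ _ hB) (rtr_funmx1 _ A B).
rewrite -sumrB; apply: eq_bigr => i _; rewrite -sumrB; apply: eq_bigr => j _; ring.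
Qed.

Lemma rtr_funmxM_subl_sqr f A B : hermmx A -> hermmx B ->
  rtr (funmx f A *m ((B - A) *m (B - A))) =
  \sum_i \sum_j overlap A B i j * (f (eigv A i) * (eigv B j - eigv A i) ^+ 2).
Proof.
move=> hA hB.
have e1 : rtr (funmx f A *m (B *m B)) =
   \sum_i \sum_j overlap A B i j * (f (eigv A i) * eigv B j ^+ 2).
  rewrite -{1}(funmx_id hB) funmxMid// rtr_funmxM.
  by apply: eq_bigr => i _; apply: eq_bigr => j _; rewrite expr2.
have e2 : rtr (funmx f A *m (A *m B)) =
   \sum_i \sum_j overlap A B i j * (f (eigv A i) * eigv A i * eigv B j).
  by rewrite mulmxA funmxMid// rtr_funmxMl.
(* The two cross terms of the square agree under the trace: by cyclicity [A] moves to the front, and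
   it commutes with f(A). *)
have e3 : rtr (funmx f A *m (B *m A)) = rtr (funmx f A *m (A *m B)).
  rewrite mulmxA (rtrC (funmx f A *m B) A) !mulmxA.
  rewrite (funmxMidl _ hA) (funmxMid _ hA).
  congr (rtr (funmx _ A *m B)); apply/funext => x; exact: mulrC.
have e4 : rtr (funmx f A *m (A *m A)) =
   \sum_i \sum_j overlap A B i j * (f (eigv A i) * eigv A i * eigv A i * 1).
  by rewrite mulmxA !funmxMid// (rtr_funmx1 _ A B).
rewrite rtrM_sqrB e3 e1 e2 e4.
rewrite -!sumrB; apply: eq_bigr => i _.
rewrite -!sumrB; apply: eq_bigr => j _; ring.
Qed.

Lemma opp_mul2 n (D : 'M[C]_n) : (- D) *m (- D) = D *m D.
Proof. by rewrite mulNmx mulmxN opprK. Qed.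

Lemma rtr_mexp_trapezoid A B : hermmx A -> hermmx B ->
  rtr (mexp B *m (B - A)) - rtr (mexp A *m (B - A)) <=
  2^-1 * (rtr (mexp A *m ((B - A) *m (B - A))) +
          rtr (mexp B *m ((B - A) *m (B - A)))).
Proof.
move=> hA hB.
have -> : rtr (mexp B *m (B - A)) =
    \sum_i \sum_j overlap A B i j * (expR (eigv B j) * (eigv B j - eigv A i)).
  (* [rtr_funmxM_subl] expands a function of the subtracted matrix, so [A] and [B] trade roles at
     the cost of a sign, and the double sum is transposed. *)
  have -> : B - A = (-1)%:C *: (A - B) by rewrite rmorphN scaleN1r opprB.
  rewrite rtrMZ rtr_funmxM_subl// exchange_big mulN1r -sumrN.
  apply: eq_bigr => i _; rewrite -sumrN; apply: eq_bigr => j _; rewrite overlapC; ring.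
have -> : rtr (mexp B *m ((B - A) *m (B - A))) =
    \sum_i \sum_j overlap A B i j *
      (expR (eigv B j) * (eigv B j - eigv A i) ^+ 2).
  have -> : (B - A) *m (B - A) = (A - B) *m (A - B) by rewrite -opp_mul2 opprB.
  rewrite rtr_funmxM_subl_sqr// exchange_big.
  apply: eq_bigr => i _; apply: eq_bigr => j _; rewrite overlapC; ring.
rewrite rtr_funmxM_subl// rtr_funmxM_subl_sqr// -sumrB -big_split mulr_sumr /=.
apply: ler_sum => i _; rewrite -sumrB -big_split mulr_sumr /=; apply: ler_sum => j _.
rewrite -mulrBr -mulrDr [leRHS]mulrCA ler_wpM2l ?overlap_ge0//.
have := expR_trapezoid (eigv A i) (eigv B j); lra.
Qed.

Variables (T : R) (X : 'M[C]_N).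
Hypotheses (T0 : 0 <= T) (hX : hermmx X) (X0T : forall j, 0 <= eigv X j <= T).

Lemma rtr_mexpM_ge0 A : 0 <= rtr (mexp A *m X).
Proof.
rewrite rtr_funmxMl// sumr_ge0// => i _; rewrite sumr_ge0// => j _.
have /andP[x0 _] := X0T j.
by rewrite !mulr_ge0 ?overlap_ge0 ?expR_ge0.
Qed.

Lemma rtr_mexpM_sqr A : rtr (mexp A *m (X *m X)) <= T * rtr (mexp A *m X).
Proof.
rewrite -{1}(funmx_id hX) funmxMid// rtr_funmxM rtr_funmxMl// mulr_sumr.
apply: ler_sum => i _; rewrite mulr_sumr; apply: ler_sum => j _.
have /andP[x0 xT] := X0T j.
rewrite [leRHS]mulrCA ler_wpM2l ?overlap_ge0// [leRHS]mulrCA ler_wpM2l ?expR_ge0//.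
by rewrite ler_wpM2r.
Qed.

Lemma rtr_mexpM_le A : rtr (mexp A *m X) <= T * rtr (mexp A).
Proof.
rewrite rtr_funmxMl// (rtr_funmx1 _ A X) mulr_sumr.
apply: ler_sum => i _; rewrite mulr_sumr; apply: ler_sum => j _.
have /andP[x0 xT] := X0T j.
by rewrite [leRHS]mulrCA ler_wpM2l ?overlap_ge0// [leRHS]mulrCA ler_wpM2l ?expR_ge0// mulr1.
Qed.

(** With B - A = sX the trapezoid bound has s^2 in front of the traces against X^2. As s^2 >= 0,
    these are bounded through X^2 <= T X whatever the sign of [s]; what remains is a
    rearrangement. *)
Lemma rtr_mexpM_step A B (s : R) : hermmx A -> B = A + s%:C *: X ->
  s * rtr (mexp B *m X) * (1 - s * T / 2) <= s * rtr (mexp A *m X) * (1 + s * T / 2).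
Proof.
move=> hA eB; have hB : hermmx B by rewrite eB; apply/hermmxD/hermmxZ.
have := rtr_mexp_trapezoid hA hB.
have -> : B - A = s%:C *: X by rewrite eB addrAC subrr add0r.
rewrite !rtrM_sqrZ !rtrMZ.
have := ler_wpM2l (sqr_ge0 s) (rtr_mexpM_sqr A).
have := ler_wpM2l (sqr_ge0 s) (rtr_mexpM_sqr B).
move: (rtr (mexp A *m X)) (rtr (mexp B *m X)) => u v.
move: (rtr (mexp A *m (X *m X))) (rtr (mexp B *m (X *m X))) => u2 v2.
by rewrite !expr2; lra.
Qed.

(** Klein's inequality with the tangent taken at the endpoint [B], which gives the increment in the
    form the scalar recursion expects. *)
Lemma rtr_mexp_step A B (s : R) : hermmx A -> B = A + s%:C *: X ->
  rtr (mexp B) - rtr (mexp A) <= s * rtr (mexp B *m X).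
Proof.
move=> hA eB; have hB : hermmx B by rewrite eB; apply/hermmxD/hermmxZ.
have := klein hB hA.
have -> : A - B = (- s)%:C *: X.
  by rewrite eB opprD addrA subrr add0r rmorphN scaleNr.
rewrite rtrMZ; move: (rtr (mexp B *m X)) (rtr (mexp A)) (rtr (mexp B)) => u a b; lra.
Qed.

Lemma rtr_mexp_shift A (s : R) : hermmx A ->
  T * (rtr (mexp (A + s%:C *: X)) - rtr (mexp A)) <=
  (expR (s * T) - 1) * rtr (mexp A *m X).
Proof.
move=> hA; rewrite [leRHS]mulrC; apply: expR_refine_limit.
near=> n.
(* The path from A to A + sX is cut into n + 1 equal steps, so that the division is always
   legitimate. *)
pose d := s / n.+1%:R.
pose A_ k := A + (k%:R * d)%:C *: X.
have hA_ k : hermmx (A_ k) by apply/hermmxD/hermmxZ.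
have AS k : A_ k.+1 = A_ k + d%:C *: X.
  by rewrite /A_ -addrA -scalerDl -natr1 mulrDl mul1r rmorphD.
have An : A_ n.+1 = A + s%:C *: X.
  by rewrite /A_ /d mulrCA mulfV ?mulr1// pnatr_eq0.
have A0 : A_ 0%N = A by rewrite /A_ mul0r scale0r addr0.
have dT2 (u : R) : u = 2 * (u / 2) by field.
have := @geometric_recursion_expR R T d (d * T / 2) (fun k => rtr (mexp (A_ k)))
  (fun k => rtr (mexp (A_ k) *m X)) T0 (dT2 _) _ _
  (fun k => rtr_mexpM_step (hA_ k) (AS k)) (fun k => rtr_mexp_step (hA_ k) (AS k)) n.+1.
rewrite A0 An (_ : d * T / 2 = s * T * n.+1%:R^-1 / 2); last first.
  by rewrite /d (mulrAC s).
(* For large n the half step x lies in (-1, 1), where the ratio (1 + x) / (1 - x) is positive. *)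
have hx : `|s * T * n.+1%:R^-1 / 2| < 1.
  by near: n; apply: cvgr0_norm_lt => //; exact: cvg_refine_step.
move: hx; rewrite ltr_norml => /andP[h1 h2] /(_ h2 h1 (rtr_mexpM_ge0 A)).
rewrite (_ : n.+1%:R * _ = s * T / (1 - s * T * n.+1%:R^-1 / 2))//.
move: h2; set y := s * T * _ / 2 => h2.
rewrite (_ : s * T = n.+1%:R * (2 * y)); first by rewrite mulrA.
by rewrite /y; field; rewrite nat1r pnatr_eq0.
Unshelve. all: by end_near.
Qed.

End Step.

(** * Eigenvalues and matrix entries *)

Section Eigenvalues.
Context {R : realType}.
Local Notation C := R[i].
Local Notation "x %:C" := (real_complex R x).
Local Notation Re := (@complex.Re R).
Local Notation Im := (@complex.Im R).
Variable N : nat.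
Implicit Types A B M : 'M[C]_N.

Lemma eigmx_mul A : hermmx A ->
  eigmx A *m A = diag_mx (\row_j (eigv A j)%:C) *m eigmx A.
Proof.
move=> hA; have := funmx_id hA; rewrite funmxE => e.
by rewrite -[X in _ *m X]e !mulmxA eigmxKV mul1mx.
Qed.

Lemma eigenvalue_eigv A j : hermmx A -> eigenvalue A (eigv A j)%:C.
Proof.
move=> hA; apply/eigenvalueP; exists (row j (eigmx A)).
  rewrite -row_mul eigmx_mul// row_mul.
  apply/rowP => k; rewrite !mxE (bigD1 j)//= big1 ?addr0; last first.
    by move=> i /negbTE ij; rewrite !mxE eq_sym ij mulr0n mul0r.
  by rewrite !mxE eqxx mulr1n.
apply/eqP => r0; have := congr1 (fun M : 'M[C]_N => M j j) (eigmxKV A).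
rewrite mxE big1; last first.
  by move=> k _; have /rowP/(_ k) := r0; rewrite !mxE => ->; rewrite mul0r.
by rewrite mxE eqxx => /eqP; rewrite eq_sym oner_eq0.
Qed.

Lemma eigenvalueE A (t : R) : hermmx A -> eigenvalue A t%:C ->
  exists j, t = eigv A j.
Proof.
move=> hA /eigenvalueP[v vA v0].
(* The coordinates of the left eigenvector [v] in the eigenbasis; any nonzero one forces [t] to be
   the eigenvalue at that index. *)
pose u := v *m ctrmx (eigmx A).
have uU : u *m eigmx A = v by rewrite -mulmxA eigmxVK mulmx1.
have ud : u *m diag_mx (\row_j (eigv A j)%:C) = t%:C *: u.
  have e : u *m diag_mx (\row_j (eigv A j)%:C) *m eigmx A = t%:C *: v.
    by rewrite -mulmxA -eigmx_mul// mulmxA uU.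
  by rewrite -[LHS]mulmx1 -(eigmxKV A) mulmxA e -scalemxAl.
clearbody u.
have [/existsP[j uj]|/existsPn h] := boolP [exists j, u 0 j != 0].
  exists j; have /rowP/(_ j) := ud.
  rewrite mul_mx_diag !mxE => /eqP.
  rewrite mulrC -subr_eq0 -mulrBl mulf_eq0 (negbTE uj) orbF subr_eq0 => /eqP h.
  exact/esym/(@complexI R).
case/eqP: v0; rewrite -uU; have -> : u = 0; last by rewrite mul0mx.
by apply/rowP => j; have := h j; rewrite negbK mxE => /eqP.
Qed.

Lemma eigenvalue_scale A (a t : R) :
  eigenvalue A t%:C -> eigenvalue (a%:C *: A) (a * t)%:C.
Proof.
move=> /eigenvalueP[v vA v0]; apply/eigenvalueP; exists v => //.
by rewrite -scalemxAr vA scalerA -rmorphM.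
Qed.

(** The eigenbases of [A] and of its multiple are chosen separately, so the indices need not match.
    The proof divides by [a], hence the separate case of the zero matrix. *)
Lemma eigv_scale A (a : R) j : hermmx A ->
  exists i, eigv (a%:C *: A) j = a * eigv A i.
Proof.
move=> hA; have haA := hermmxZ a hA.
have := eigenvalue_eigv j haA.
have [->|a0] := eqVneq a 0.
  have h0 := hermmxZ 0 hA.
  move=> _; exists j; have := eigenvalue_eigv j h0.
  rewrite scale0r mul0r => /eigenvalueP[v]; rewrite mulmx0 => /esym/eqP.
  by rewrite scaler_eq0 => /orP[/eqP/(@complexI R)//|/eqP->]; rewrite eqxx.
move=> /(eigenvalue_scale a^-1); rewrite scalerA -rmorphM mulVf// scale1r.
move=> /(eigenvalueE hA)[i e]; exists i; rewrite -e mulrA mulfV ?mul1r//.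
Qed.

Lemma rtr_mexp A : rtr (mexp A) = \sum_j expR (eigv A j).
Proof. exact: rtr_funmx. Qed.

Lemma rtr_mexp_ge0 A : 0 <= rtr (mexp A).
Proof. by rewrite rtr_mexp sumr_ge0// => j _; exact: expR_ge0. Qed.

Lemma expR_eigenvalue_le A (s t : R) : hermmx A -> eigenvalue A t%:C ->
  expR (s * t) <= rtr (mexp (s%:C *: A)).
Proof.
move=> hA /(eigenvalue_scale s) /(eigenvalueE (hermmxZ s hA))[j ->].
by rewrite rtr_mexp (bigD1 j)//= lerDl sumr_ge0// => i _; exact: expR_ge0.
Qed.

Lemma rtr_mexp_le A (s K : R) : hermmx A ->
  (forall j, expR (s * eigv A j) <= K) -> rtr (mexp (s%:C *: A)) <= N%:R * K.
Proof.
move=> hA hK; rewrite rtr_mexp.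
apply: (@le_trans _ _ (\sum_(j < N) K)).
  by apply: ler_sum => j _; have [i ->] := eigv_scale s j hA.
by rewrite sumr_const card_ord mulr_natl.
Qed.

Definition mxlmax A : R := sup [set t | eigenvalue A t%:C].
Definition mxlmin A : R := inf [set t | eigenvalue A t%:C].

Lemma eigenvalues_has_sup A : (0 < N)%N -> hermmx A ->
  has_sup [set t | eigenvalue A t%:C].
Proof.
move=> N0 hA; split; first by exists (eigv A (Ordinal N0)); exact: eigenvalue_eigv.
exists (\sum_j `|eigv A j|) => t /= /(eigenvalueE hA)[j ->].
by rewrite (bigD1 j)//= (le_trans (ler_norm _))// lerDl sumr_ge0.
Qed.

Lemma eigv_le_mxlmax A j : hermmx A -> eigv A j <= mxlmax A.
Proof.
move=> hA; have N0 : (0 < N)%N by case: j => j; case: (N).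
by apply: sup_ubound; [exact: (eigenvalues_has_sup N0 hA).2|exact: eigenvalue_eigv].
Qed.

Lemma eigenvalue_mxlmax A : (0 < N)%N -> hermmx A -> eigenvalue A (mxlmax A)%:C.
Proof.
move=> N0 hA; pose j0 := Ordinal N0.
pose j := [arg max_(i > j0) eigv A i]%O.
suff -> : mxlmax A = eigv A j by exact: eigenvalue_eigv.
apply/le_anti/andP; split; last exact: eigv_le_mxlmax.
apply: ge_sup; first exact: (eigenvalues_has_sup N0 hA).1.
move=> t /= /(eigenvalueE hA)[i ->]; rewrite /j.
by case: arg_maxP => // k _; apply.
Qed.

(** Reduces every fact on the smallest eigenvalue to the largest one; the opposite is written as a
    scaling so that [eigenvalue_scale] applies. *)
Lemma mxlminE A : mxlmin A = - mxlmax ((-1)%:C *: A).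
Proof.
rewrite /mxlmin /inf /mxlmax; congr (- sup _); apply/seteqP; split => t /=.
  by move=> [u /= hu <-]; rewrite -(mulN1r u); exact: eigenvalue_scale.
move=> /(eigenvalue_scale (-1)); rewrite scalerA -rmorphM mulrNN mulr1 scale1r => h.
by exists (-1 * t) => //; rewrite mulN1r opprK.
Qed.

Lemma mxlmin_le_eigv A j : hermmx A -> mxlmin A <= eigv A j.
Proof.
move=> hA; rewrite mxlminE lerNl.
have h1 := hermmxZ (-1) hA.
have /(eigenvalue_scale (-1)) /(eigenvalueE h1)[i e] := eigenvalue_eigv j hA.
by rewrite -(mulN1r (eigv A j)) e; exact: eigv_le_mxlmax.
Qed.

Lemma eigenvalue_mxlmin A : (0 < N)%N -> hermmx A -> eigenvalue A (mxlmin A)%:C.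
Proof.
move=> N0 hA; have := eigenvalue_mxlmax N0 (hermmxZ (-1) hA).
move=> /(eigenvalue_scale (-1)); rewrite scalerA -rmorphM mulrNN mulr1 scale1r.
by rewrite mulN1r -mxlminE.
Qed.

Lemma eigmx_row_sqr A j : \sum_a (Re (eigmx A j a) ^+ 2 + Im (eigmx A j a) ^+ 2) = 1.
Proof.
have := congr1 (fun M : 'M[C]_N => Re (M j j)) (eigmxKV A).
rewrite mxE mxE eqxx /= Re_sum => <-; apply: eq_bigr => a _.
by rewrite mxE; case: (eigmx A j a) => x y /=; ring.
Qed.

(** The (a, b) entry of the orthogonal projection onto the j-th eigenvector. *)
Definition eigw A (a b j : 'I_N) : C := conjc (eigmx A j a) * eigmx A j b.

Lemma funmx_entry f A a b : funmx f A a b = \sum_j (f (eigv A j))%:C * eigw A a b j.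
Proof.
rewrite funmxE mxE; apply: eq_bigr => j _.
by rewrite mul_mx_diag !mxE mulrAC mulrC /eigw.
Qed.

(** The quadratic form at the j-th unit eigenvector equals the eigenvalue. *)
Lemma psd_eigv_ge0 A j : psd_mx A -> 0 <= eigv A j.
Proof.
move=> [hA /(_ (ctrmx (row j (eigmx A))))].
rewrite ctrmxK -row_mul eigmx_mul// row_mul.
move=> h; rewrite -(@ler0c R); congr (0 <= _) : h.
have e := congr1 (fun M : 'M[C]_N => M j j) (eigmxKV A).
rewrite mxE mxE eqxx in e.
rewrite mxE -[RHS]mulr1 -[X in _ * X]e mulr_sumr; apply: eq_bigr => k _.
rewrite !mxE (bigD1 j)//= big1 ?addr0; last first.
  by move=> i /negbTE ij; rewrite !mxE eq_sym ij mulr0n mul0r.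
by rewrite !mxE eqxx mulr1n mulrA.
Qed.

Lemma eigmx_entry_sqr A j a : Re (eigmx A j a) ^+ 2 + Im (eigmx A j a) ^+ 2 <= 1.
Proof.
rewrite -(eigmx_row_sqr A j) (bigD1 a)//= lerDl sumr_ge0// => i _.
by rewrite addr_ge0 ?sqr_ge0.
Qed.

Lemma sqr_bound_mul (x y u v : R) : x ^+ 2 + y ^+ 2 <= 1 -> u ^+ 2 + v ^+ 2 <= 1 ->
  `|x * u + y * v| <= 1.
Proof.
move=> h1 h2; rewrite ler_norml; apply/andP; split.
  have := sqr_ge0 (x + u); have := sqr_ge0 (y + v); move: h1 h2; rewrite !expr2; nra.
have := sqr_ge0 (x - u); have := sqr_ge0 (y - v); move: h1 h2; rewrite !expr2; nra.
Qed.

Lemma eigw_bound A a b j : `|Re (eigw A a b j)| <= 1 /\ `|Im (eigw A a b j)| <= 1.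
Proof.
have := eigmx_entry_sqr A j a; have := eigmx_entry_sqr A j b.
rewrite /eigw; case: (eigmx A j a) => x y; case: (eigmx A j b) => u v /= h1 h2; split.
  by rewrite mulNr opprK; exact: sqr_bound_mul.
rewrite mulNr; have := @sqr_bound_mul x (- y) v u.
by rewrite mulNr sqrrN (addrC (v ^+ 2)); exact.
Qed.

Lemma funmx_entry_bound f A a b :
  `|Re (funmx f A a b)| <= \sum_j `|f (eigv A j)| /\
  `|Im (funmx f A a b)| <= \sum_j `|f (eigv A j)|.
Proof.
rewrite funmx_entry; split.
  rewrite Re_sum (le_trans (ler_norm_sum _ _ _))// ler_sum// => j _.
  by rewrite ReZ normrM ler_piMr//; have [] := eigw_bound A a b j.
rewrite Im_sum (le_trans (ler_norm_sum _ _ _))// ler_sum// => j _.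
by rewrite ImZ normrM ler_piMr//; have [] := eigw_bound A a b j.
Qed.

(** The entries are polynomials in the entries of [A], which is what makes the exponential
    measurable. *)
Definition mxpow k A : 'M[C]_N := iter k (mulmx A) 1%:M.

Lemma mxpowE k A : hermmx A -> mxpow k A = funmx (fun x => x ^+ k) A.
Proof.
move=> hA; elim: k => [|k IH]; first exact: esym (funmx1 A).
rewrite /= -/(mxpow k A) IH (funmxMidl _ hA).
by congr (funmx _ A); apply/funext => x; rewrite exprS.
Qed.

(** All powers of [A] share its eigenbasis, so the exponential series of an entry is a finite
    combination of scalar ones: [w] are the eigenvalues, [c] the real or imaginary parts of
    [eigw]. *)
Lemma funmx_series_cvg (w : 'I_N -> R) (c : 'I_N -> R) :
  (fun n => \sum_(k < n) (k`!%:R)^-1 * \sum_j w j ^+ k * c j) @ \oo -->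
  \sum_j expR (w j) * c j.
Proof.
have -> : (fun n => \sum_(k < n) (k`!%:R)^-1 * \sum_j w j ^+ k * c j) =
    (fun n => \sum_j series (exp_coeff (w j)) n * c j).
  apply/funext => n; under eq_bigr do rewrite mulr_sumr.
  rewrite exchange_big /=; apply: eq_bigr => j _.
  rewrite /series /= big_mkord mulr_suml; apply: eq_bigr => k _.
  by rewrite exp_coeffE; ring.
apply: cvg_big => [|j _]; first exact: add_continuous.
apply: cvgMl.
exact: is_cvg_series_exp_coeff.
Qed.

Lemma Re_mexp_entry_cvg A a b : hermmx A ->
  (fun n => \sum_(k < n) (k`!%:R)^-1 * Re (mxpow k A a b)) @ \oo --> Re (mexp A a b).
Proof.
move=> hA.
have e f : Re (funmx f A a b) = \sum_j f (eigv A j) * Re (eigw A a b j).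
  by rewrite funmx_entry Re_sum; apply: eq_bigr => j _; rewrite ReZ.
rewrite /mexp e.
have -> : (fun n => \sum_(k < n) (k`!%:R)^-1 * Re (mxpow k A a b)) =
    (fun n => \sum_(k < n) (k`!%:R)^-1 * \sum_j eigv A j ^+ k * Re (eigw A a b j)).
  by apply/funext => n; apply: eq_bigr => k _; rewrite mxpowE// e.
exact: funmx_series_cvg.
Qed.

Lemma Im_mexp_entry_cvg A a b : hermmx A ->
  (fun n => \sum_(k < n) (k`!%:R)^-1 * Im (mxpow k A a b)) @ \oo --> Im (mexp A a b).
Proof.
move=> hA.
have e f : Im (funmx f A a b) = \sum_j f (eigv A j) * Im (eigw A a b j).
  by rewrite funmx_entry Im_sum; apply: eq_bigr => j _; rewrite ImZ.
rewrite /mexp e.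
have -> : (fun n => \sum_(k < n) (k`!%:R)^-1 * Im (mxpow k A a b)) =
    (fun n => \sum_(k < n) (k`!%:R)^-1 * \sum_j eigv A j ^+ k * Im (eigw A a b j)).
  by apply/funext => n; apply: eq_bigr => k _; rewrite mxpowE// e.
exact: funmx_series_cvg.
Qed.

End Eigenvalues.

(** * Random matrices *)

Section RandomMatrices.
Context d {Omega : measurableType d} {R : realType} {N : nat}.
Local Notation C := R[i].
Local Notation "x %:C" := (real_complex R x).
Local Notation Re := (@complex.Re R).
Local Notation Im := (@complex.Im R).
Implicit Types Y Z : Omega -> 'M[C]_N.

Definition measurable_mx Y := forall a b,
  measurable_fun setT (fun w => Re (Y w a b)) /\
  measurable_fun setT (fun w => Im (Y w a b)).

Lemma measurable_mx_cst (M : 'M[C]_N) : measurable_mx (fun=> M).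
Proof. by move=> a b; split; exact: measurable_cst. Qed.

Lemma measurable_mxD Y Z : measurable_mx Y -> measurable_mx Z ->
  measurable_mx (fun w => Y w + Z w).
Proof.
move=> mY mZ a b; split.
  under eq_fun do rewrite mxE ReD.
  by apply: measurable_funD; [exact: (mY a b).1|exact: (mZ a b).1].
under eq_fun do rewrite mxE ImD.
by apply: measurable_funD; [exact: (mY a b).2|exact: (mZ a b).2].
Qed.

Lemma measurable_mxZ (s : R) Y : measurable_mx Y ->
  measurable_mx (fun w => s%:C *: Y w).
Proof.
move=> mY a b; split.
  under eq_fun do rewrite mxE ReZ.
  by apply: measurable_funM; [exact: measurable_cst|exact: (mY a b).1].
under eq_fun do rewrite mxE ImZ.
by apply: measurable_funM; [exact: measurable_cst|exact: (mY a b).2].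
Qed.

Lemma measurable_mx_sum (I : Type) (r : seq I) (Q : pred I) (F : I -> Omega -> 'M[C]_N) :
  (forall i, Q i -> measurable_mx (F i)) ->
  measurable_mx (fun w => \sum_(i <- r | Q i) F i w).
Proof.
move=> mF; elim: r => [|i r IH].
  by under eq_fun do rewrite big_nil; exact: measurable_mx_cst.
have [Qi|/negbTE Qi] := boolP (Q i); under eq_fun do rewrite big_cons Qi; last exact: IH.
exact: measurable_mxD (mF _ Qi) IH.
Qed.

Lemma Re_mul (x y : C) : Re (x * y) = Re x * Re y - Im x * Im y.
Proof. by case: x; case: y. Qed.
Lemma Im_mul (x y : C) : Im (x * y) = Re x * Im y + Im x * Re y.
Proof. by case: x; case: y. Qed.

Lemma measurable_mxM Y Z : measurable_mx Y -> measurable_mx Z ->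
  measurable_mx (fun w => Y w *m Z w).
Proof.
move=> mY mZ a b; split.
  under eq_fun do rewrite mxE Re_sum; apply: measurable_sum => k.
  under eq_fun do rewrite Re_mul.
  apply: measurable_funB; apply: measurable_funM.
  - exact: (mY _ _).1.
  - exact: (mZ _ _).1.
  - exact: (mY _ _).2.
  - exact: (mZ _ _).2.
under eq_fun do rewrite mxE Im_sum; apply: measurable_sum => k.
under eq_fun do rewrite Im_mul.
apply: measurable_funD; apply: measurable_funM.
- exact: (mY _ _).1.
- exact: (mZ _ _).2.
- exact: (mY _ _).2.
- exact: (mZ _ _).1.
Qed.

Lemma measurable_mxpow k Y : measurable_mx Y -> measurable_mx (fun w => mxpow k (Y w)).
Proof.
move=> mY; elim: k => [|k IH]; first exact: measurable_mx_cst.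
exact: measurable_mxM mY IH.
Qed.

Lemma measurable_mexp Y : (forall w, hermmx (Y w)) -> measurable_mx Y ->
  measurable_mx (fun w => mexp (Y w)).
Proof.
move=> hY mY a b; split.
  apply: (@measurable_fun_cvg _ _ _ _ (fun n w =>
    \sum_(k < n) (k`!%:R)^-1 * Re (mxpow k (Y w) a b))).
    move=> n; apply: measurable_sum => k; apply: measurable_funM; first exact: measurable_cst.
    exact: (measurable_mxpow k mY a b).1.
  by move=> w _; exact: Re_mexp_entry_cvg.
apply: (@measurable_fun_cvg _ _ _ _ (fun n w =>
    \sum_(k < n) (k`!%:R)^-1 * Im (mxpow k (Y w) a b))).
  move=> n; apply: measurable_sum => k; apply: measurable_funM; first exact: measurable_cst.
  exact: (measurable_mxpow k mY a b).2.
by move=> w _; exact: Im_mexp_entry_cvg.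
Qed.

Lemma measurable_rtr Y : measurable_mx Y -> measurable_fun setT (fun w => rtr (Y w)).
Proof.
move=> mY; rewrite /rtr; under eq_fun do rewrite Re_sum.
by apply: measurable_sum => k; exact: (mY k k).1.
Qed.

(** With l the largest eigenvalue, e^(kl) <= tr e^(kA) <= N e^(kl); after taking logarithms and
    dividing by k the two bounds differ by ln N / k. *)
Lemma mxlmax_cvg (A : 'M[C]_N) : (0 < N)%N -> hermmx A ->
  (fun n => n.+1%:R^-1 * ln (rtr (mexp (n.+1%:R%:C *: A)))) @ \oo --> mxlmax A.
Proof.
move=> N0 hA.
have NR : 0 < N%:R :> R by rewrite ltr0n.
have lo n : expR (n.+1%:R * mxlmax A) <= rtr (mexp (n.+1%:R%:C *: A)).
  by apply: expR_eigenvalue_le => //; exact: eigenvalue_mxlmax.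
have hi n : rtr (mexp (n.+1%:R%:C *: A)) <= N%:R * expR (n.+1%:R * mxlmax A).
  apply: rtr_mexp_le => // j; rewrite ler_expR ler_wpM2l//.
  exact: eigv_le_mxlmax.
have pos n : 0 < rtr (mexp (n.+1%:R%:C *: A)) by apply: lt_le_trans (lo n); exact: expR_gt0.
apply: (@squeeze_cvgr _ _ _ _ (cst (mxlmax A)) (fun n => n.+1%:R^-1 * ln N%:R + mxlmax A)).
- near=> n; apply/andP; split.
    rewrite -(@ler_pM2l _ n.+1%:R) ?ltr0n// mulrA mulfV ?pnatr_eq0// mul1r.
    by rewrite -[leLHS]expRK ler_ln ?posrE ?expR_gt0//.
  rewrite -(@ler_pM2l _ n.+1%:R) ?ltr0n// mulrA mulfV ?pnatr_eq0// mul1r mulrDr.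
  rewrite mulrA mulfV ?pnatr_eq0// mul1r -[X in _ + X]expRK -lnM ?posrE ?expR_gt0//.
  by rewrite ler_ln ?posrE ?mulr_gt0 ?expR_gt0.
- exact: cvg_cst.
- rewrite -[X in _ --> X]add0r -[X in X + _](mul0r (ln N%:R)).
  by apply: cvgD; [apply: cvgMl; exact: cvg_harmonic|exact: cvg_cst].
Unshelve. all: by end_near.
Qed.

Lemma measurable_mxlmax Y : (0 < N)%N -> (forall w, hermmx (Y w)) -> measurable_mx Y ->
  measurable_fun setT (fun w => mxlmax (Y w)).
Proof.
move=> N0 hY mY.
apply: (@measurable_fun_cvg _ _ _ _ (fun n w =>
  n.+1%:R^-1 * ln (rtr (mexp (n.+1%:R%:C *: Y w))))).
  move=> n; apply: measurable_funM; first exact: measurable_cst.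
  apply: measurableT_comp => //.
  apply: measurable_rtr; apply: measurable_mexp; last exact: measurable_mxZ.
  by move=> w; exact: hermmxZ.
by move=> w _; exact: mxlmax_cvg.
Qed.

Lemma measurable_mxlmin Y : (0 < N)%N -> (forall w, hermmx (Y w)) -> measurable_mx Y ->
  measurable_fun setT (fun w => mxlmin (Y w)).
Proof.
move=> N0 hY mY; under eq_fun do rewrite mxlminE.
apply: measurableT_comp => //; apply: measurable_mxlmax => //.
  by move=> w; exact: hermmxZ.
exact: measurable_mxZ.
Qed.

End RandomMatrices.

(** * Expectation and independence of almost surely bounded variables *)

Section AeBounded.
Context d {Omega : measurableType d} {R : realType} (P : probability Omega R).
Implicit Types f g : Omega -> R.

(** A class of integrable functions closed under products as well as sums, so that integrability is
    inherited by every expression built from the entries. *)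
Definition aebounded f := measurable_fun setT f /\
  exists M : R, {ae P, forall w, `|f w| <= M}.

Lemma aebounded_integrable f : aebounded f -> P.-integrable setT (EFin \o f).
Proof.
move=> [mf [M hM]]; apply/integrableP; split; first exact/measurable_EFinP.
apply: (@le_lt_trans _ _ (\int[P]_w (cst `|M|%:E w))%E).
  apply: ae_ge0_le_integral => //.
  - by apply: measurableT_comp => //; exact/measurable_EFinP.
  - by move=> w _ /=; rewrite lee_fin.
  - by apply: filterS hM => w h _ /=; rewrite lee_fin (le_trans h)// ler_norm.
by rewrite integral_cst//= probability_setT mule1 ltry.
Qed.

Lemma ae_imp2 (A B : Omega -> Prop) (Q : Omega -> Prop) : (forall w, A w -> B w -> Q w) ->
  {ae P, forall w, A w} -> {ae P, forall w, B w} -> {ae P, forall w, Q w}.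
Proof. by move=> ABQ hA hB; apply: filterS2 hA hB. Qed.

Lemma aebounded_cst (c : R) : aebounded (fun=> c).
Proof.
split; first exact: measurable_cst.
by exists `|c|; apply: aeW => w.
Qed.

Lemma aeboundedD f g : aebounded f -> aebounded g -> aebounded (fun w => f w + g w).
Proof.
move=> [mf [M hM]] [mg [K hK]]; split; first exact: measurable_funD.
exists (M + K); apply: ae_imp2 hM hK => w h1 h2.
exact: le_trans (ler_normD _ _) (lerD h1 h2).
Qed.

Lemma aeboundedM f g : aebounded f -> aebounded g -> aebounded (fun w => f w * g w).
Proof.
move=> [mf [M hM]] [mg [K hK]]; split; first exact: measurable_funM.
exists (M * K); apply: ae_imp2 hM hK => w h1 h2.
by rewrite normrM ler_pM.
Qed.

Lemma aeboundedZ (c : R) f : aebounded f -> aebounded (fun w => c * f w).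
Proof. exact: aeboundedM (aebounded_cst c). Qed.

Lemma aebounded_sum (I : Type) (r : seq I) (F : I -> Omega -> R) :
  (forall i, aebounded (F i)) -> aebounded (fun w => \sum_(i <- r) F i w).
Proof.
move=> hF; elim: r => [|i r IH].
  by under eq_fun do rewrite big_nil; exact: aebounded_cst.
under eq_fun do rewrite big_cons; exact: aeboundedD.
Qed.

Local Notation E f := (\int[P]_w f w).

Lemma Rexp_cst (c : R) : E (fun=> c) = c.
Proof. by rewrite Rintegral_cst//= probability_setT mulr1. Qed.

Lemma RexpD f g : aebounded f -> aebounded g -> E (fun w => f w + g w) = E f + E g.
Proof. by move=> hf hg; rewrite RintegralD//; exact: aebounded_integrable. Qed.

Lemma RexpZ c f : aebounded f -> E (fun w => c * f w) = c * E f.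
Proof. by move=> hf; rewrite RintegralZl//; exact: aebounded_integrable. Qed.

Lemma Rexp_sum (I : Type) (r : seq I) (F : I -> Omega -> R) :
  (forall i, aebounded (F i)) ->
  E (fun w => \sum_(i <- r) F i w) = \sum_(i <- r) E (F i).
Proof.
move=> hF; elim: r => [|i r IH].
  by under eq_fun do rewrite big_nil; rewrite big_nil Rexp_cst.
under eq_fun do rewrite big_cons; rewrite RexpD ?IH ?big_cons//.
exact: aebounded_sum.
Qed.

Lemma Rexp_ge0 f : aebounded f -> {ae P, forall w, 0 <= f w} -> 0 <= E f.
Proof.
move=> hf f0; rewrite /Rintegral fine_ge0//.
rewrite (@ae_eq_integral _ _ _ P setT (EFin \o (fun w => `|f w|)) (EFin \o f))//.
- by apply: integral_ge0 => w _; rewrite lee_fin.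
- by apply/measurable_EFinP; exact: hf.1.
- by apply/measurable_EFinP; apply: measurableT_comp => //; exact: hf.1.
- by apply: filterS f0 => w f0 _ /=; rewrite ger0_norm.
Qed.

Lemma Rexp_le f g : aebounded f -> aebounded g ->
  {ae P, forall w, f w <= g w} -> E f <= E g.
Proof.
move=> hf hg fg; rewrite -subr_ge0 -mulN1r -RexpZ// -RexpD//; last exact: aeboundedZ.
apply: Rexp_ge0; first by apply: aeboundedD => //; exact: aeboundedZ.
by apply: filterS fg => w; rewrite mulN1r subr_ge0.
Qed.

Lemma Rexp_markov f (a : R) : aebounded f -> (forall w, 0 <= f w) ->
  measurable [set w | a <= f w] ->
  (a%:E * P [set w | (a <= f w)%R] <= (E f)%:E)%E.
Proof.
move=> hf f0 mA; rewrite fineK; last first.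
  exact/integrable_fin_num/aebounded_integrable.
move: mA; set S := [set w | a <= f w] => mS.
have -> : (a%:E * P S = \int[P]_(w in S) a%:E)%E by rewrite integral_cst.
have mf : measurable_fun setT (EFin \o f) by apply/measurable_EFinP; exact: hf.1.
apply: (@le_trans _ _ (\int[P]_(w in S) (f w)%:E)%E).
  have [a0|a0] := leP 0 a; last first.
    rewrite integral_cst//; apply: (@le_trans _ _ 0%E).
      by rewrite mule_le0_ge0// lee_fin ltW.
    by apply: integral_ge0 => w _; rewrite lee_fin.
  by apply: ge0_le_integral => //; exact: (measurable_funTS mf).
by apply: ge0_subset_integral => // w _; rewrite lee_fin.
Qed.

(** Independence says that the joint law and the product of the laws agree on rectangles, hence
    everywhere; Fubini then splits the integral of the product of the coordinates. *)
Lemma Rexp_mul_indep_mfun (U V : {mfun Omega >-> R}) : aebounded U -> aebounded V ->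
  (forall A B : set R, measurable A -> measurable B ->
    P (U @^-1` A `&` V @^-1` B) = (P (U @^-1` A) * P (V @^-1` B))%E) ->
  E (fun w => U w * V w) = E U * E V.
Proof.
move=> hU hV ind.
have iU := aebounded_integrable hU; have iV := aebounded_integrable hV.
have mUV : measurable_fun setT (fun w => (U w, V w)) by exact: measurable_fun_pair.
pose UV : {mfun Omega >-> (R * R)%type} := HB.pack (fun w => (U w, V w))
  (isMeasurableFun.Build _ _ _ _ (fun w => (U w, V w)) mUV).
pose pr (z : R * R) := (z.1 * z.2)%:E.
have mpr : measurable_fun setT pr.
  by apply/measurable_EFinP; apply: measurable_funM.
have ipr : P.-integrable setT (pr \o UV) by exact: (aebounded_integrable (aeboundedM hU hV)).
have eqm A : measurable A -> (distribution P U \x distribution P V)%E A = distribution P UV A.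
  by apply: product_measure_unique => B C mB mC; exact: ind.
have ipr2 : (distribution P U \x distribution P V)%E.-integrable setT pr.
  have /integrableP[_ h] := @integrable_pushforward _ _ _ _ _ _ mUV P setT pr mpr ipr measurableT.
  apply/integrableP; split => //; apply: le_lt_trans h; rewrite le_eqVlt; apply/orP; left; apply/eqP.
  by apply: eq_measure_integral => A mA _; exact: eqm.
rewrite /Rintegral.
have -> : (\int[P]_w (U w * V w)%:E = \int[distribution P UV]_z pr z)%E.
  by rewrite integral_distribution.
have -> : (\int[distribution P UV]_z pr z = \int[distribution P U \x distribution P V]_z pr z)%E.
  by apply: eq_measure_integral => A mA _; apply/esym; exact: eqm.
rewrite -integral12_prod_meas1//.
have eV : (\int[distribution P V]_y (y%:E) = (\int[P]_w V w)%:E)%E.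
  rewrite integral_distribution//.
  by rewrite /Rintegral fineK//; exact: integrable_fin_num.
have iidV : (distribution P V).-integrable setT (EFin : R -> \bar R).
  by apply: integrable_pushforward.
have e (x : R) : (\int[distribution P V]_y pr (x, y) = x%:E * (\int[P]_w V w)%:E)%E.
  rewrite -eV -integralZl//.
rewrite (eq_integral (fun x : R => x%:E * (\int[P]_w V w)%:E)%E); last first.
  by move=> x _; exact: e.
rewrite integralZr//; last by apply: integrable_pushforward.
rewrite fineM//.
- by rewrite integral_distribution.
- apply: integrable_fin_num => //; exact: integrable_pushforward.
Qed.

Lemma Rexp_mul_indep (U V : Omega -> R) : aebounded U -> aebounded V ->
  (forall A B : set R, measurable A -> measurable B ->
    P (U @^-1` A `&` V @^-1` B) = (P (U @^-1` A) * P (V @^-1` B))%E) ->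
  E (fun w => U w * V w) = E U * E V.
Proof.
move=> hU hV ind.
pose U' : {mfun Omega >-> R} := HB.pack U (isMeasurableFun.Build _ _ _ _ U hU.1).
pose V' : {mfun Omega >-> R} := HB.pack V (isMeasurableFun.Build _ _ _ _ V hV.1).
exact: (@Rexp_mul_indep_mfun U' V').
Qed.

(** Dynkin's argument: the events satisfying the product rule with a fixed [B] are closed under
    complements and disjoint countable unions, and they contain a generating family stable under
    intersection. *)
Lemma indep_sigma (G : set_system Omega) (B : set Omega) :
  G `<=` measurable -> measurable B -> setI_closed G ->
  (forall A, G A -> P (A `&` B) = (P A * P B)%E) ->
  forall A, <<s G >> A -> P (A `&` B) = (P A * P B)%E.
Proof.
move=> Gm mB GI GP A sA.
have sm S : <<s G >> S -> measurable S.
  by apply: smallest_sub => //; exact: sigma_algebra_measurable.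
pose G' : set_system (g_sigma_algebraType G) := G.
apply: (@dynkin_induction _ (g_sigma_algebraType G) G'
  (fun A => P (A `&` B) = (P A * P B)%E)) => //=.
- by rewrite setTI probability_setT mul1e.
- move=> S /sm mS e.
  have -> : P (~` S `&` B) = (P B - P (S `&` B))%E.
    rewrite setIC -setDE measureD// 1?(setIC B S)//.
    by rewrite (le_lt_trans (probability_le1 _ _))// ltry.
  rewrite e probability_setC// muleBl// ?mul1e//.
  by rewrite fin_num_measure.
- move=> F mF tF hF; have mF' n : measurable (F n : set Omega) by exact: sm (mF n).
  rewrite setI_bigcupl !measure_bigcup//; last 2 first.
  + by move=> n _; exact: measurableI.
  + exact: trivIset_setIr.
  have [b eb] : exists b, P B = b%:E.
    by exists (fine (P B)); rewrite fineK// fin_num_measure.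
  rewrite eb [RHS]muleC -nneseriesZl//.
  apply: eq_eseriesr => n _; rewrite -eb muleC; exact: hF.
Qed.

End AeBounded.

(** * Expected matrices and traces of independent products *)

Section ExpectedMatrix.
Context d {Omega : measurableType d} {R : realType} (P : probability Omega R).
Context {N : nat}.
Local Notation C := R[i].
Local Notation "x %:C" := (real_complex R x).
Local Notation Re := (@complex.Re R).
Local Notation Im := (@complex.Im R).
Local Notation E f := (\int[P]_w f w).
Implicit Types U V : Omega -> 'M[C]_N.

Definition expect_mx V : 'M[C]_N :=
  \matrix_(a, b) Complex (E (fun w => Re (V w a b))) (E (fun w => Im (V w a b))).

Definition aebounded_mx V := forall a b,
  aebounded P (fun w => Re (V w a b)) /\ aebounded P (fun w => Im (V w a b)).

Lemma rtrM (A B : 'M[C]_N) : rtr (A *m B) =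
  \sum_a \sum_b (Re (A a b) * Re (B b a) + (-1) * (Im (A a b) * Im (B b a))).
Proof.
rewrite /rtr /mxtrace Re_sum; apply: eq_bigr => a _.
by rewrite mxE Re_sum; apply: eq_bigr => b _; rewrite Re_mul mulN1r.
Qed.

Lemma aebounded_rtrM U V : aebounded_mx U -> aebounded_mx V ->
  aebounded P (fun w => rtr (U w *m V w)).
Proof.
move=> hU hV; under eq_fun do rewrite rtrM.
apply: aebounded_sum => a; apply: aebounded_sum => b.
apply: aeboundedD; last apply: aeboundedZ; apply: aeboundedM.
- exact: (hU _ _).1.
- exact: (hV _ _).1.
- exact: (hU _ _).2.
- exact: (hV _ _).2.
Qed.

Lemma aebounded_mx_cst (M : 'M[C]_N) : aebounded_mx (fun=> M).
Proof. by move=> a b; split; exact: aebounded_cst. Qed.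

Definition indep_fun (f g : Omega -> R) := forall A B : set R,
  measurable A -> measurable B ->
  P (f @^-1` A `&` g @^-1` B) = (P (f @^-1` A) * P (g @^-1` B))%E.

(** The real part of the trace contains only products of two real parts or of two imaginary parts,
    so these two families of independence suffice. Both sides are expanded alike, the right one with
    a constant matrix. *)
Lemma Rexp_rtrM_indep U V : aebounded_mx U -> aebounded_mx V ->
  (forall a b a' b', indep_fun (fun w => Re (U w a b)) (fun w => Re (V w a' b'))) ->
  (forall a b a' b', indep_fun (fun w => Im (U w a b)) (fun w => Im (V w a' b'))) ->
  E (fun w => rtr (U w *m V w)) = E (fun w => rtr (U w *m expect_mx V)).
Proof.
move=> hU hV iR iI.
have expand V' : aebounded_mx V' ->
    E (fun w => rtr (U w *m V' w)) = \sum_a \sum_b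
      (E (fun w => Re (U w a b) * Re (V' w b a)) +
       (-1) * E (fun w => Im (U w a b) * Im (V' w b a))).
  move=> hV'.
  have h1 a b : aebounded P (fun w => Re (U w a b) * Re (V' w b a)).
    by apply: aeboundedM; [exact: (hU _ _).1|exact: (hV' _ _).1].
  have h2 a b : aebounded P (fun w => Im (U w a b) * Im (V' w b a)).
    by apply: aeboundedM; [exact: (hU _ _).2|exact: (hV' _ _).2].
  have h3 a b : aebounded P (fun w => -1 * (Im (U w a b) * Im (V' w b a))).
    exact: aeboundedZ.
  rewrite (_ : (fun w => rtr (U w *m V' w)) = (fun w => \sum_a \sum_b
      (Re (U w a b) * Re (V' w b a) + (-1) * (Im (U w a b) * Im (V' w b a))))); last first.
    by apply/funext => w; exact: rtrM.
  rewrite Rexp_sum; last by move=> a; apply: aebounded_sum => b; exact: aeboundedD.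
  apply: eq_bigr => a _; rewrite Rexp_sum; last by move=> b; exact: aeboundedD.
  by apply: eq_bigr => b _; rewrite RexpD// RexpZ.
rewrite !expand//; last exact: aebounded_mx_cst.
apply: eq_bigr => a _; apply: eq_bigr => b _.
rewrite (Rexp_mul_indep (hU a b).1 (hV b a).1 (iR _ _ _ _)).
rewrite (Rexp_mul_indep (hU a b).2 (hV b a).2 (iI _ _ _ _)).
rewrite mxE /= !RintegralZr//.
- exact: aebounded_integrable (hU a b).2.
- exact: aebounded_integrable (hU a b).1.
Qed.

Lemma hermmx_expect V : aebounded_mx V -> (forall w, hermmx (V w)) -> hermmx (expect_mx V).
Proof.
move=> hV hh; apply/matrixP => a b; rewrite !mxE /=.
have e w : V w a b = conjc (V w b a) by rewrite -{1}(hh w) mxE.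
congr Complex.
  by congr Rintegral; apply/funext => w; rewrite e; case: (V w b a).
rewrite -mulN1r -RexpZ; last exact: (hV _ _).2.
by congr Rintegral; apply/funext => w; rewrite e; case: (V w b a) => x y /=; rewrite mulN1r.
Qed.

(** The eigenvalues of an exponential are positive, so its trace dominates each of its entries. *)
Lemma aebounded_mexp V : (forall w, hermmx (V w)) -> measurable_mx V ->
  aebounded P (fun w => rtr (mexp (V w))) -> aebounded_mx (fun w => mexp (V w)).
Proof.
move=> hV mV [_ [M hM]] a b.
have h w : `|Re (mexp (V w) a b)| <= rtr (mexp (V w)) /\
           `|Im (mexp (V w) a b)| <= rtr (mexp (V w)).
  rewrite rtr_mexp; have := funmx_entry_bound expR (V w) a b.
  by under eq_bigr do rewrite ger0_norm ?expR_ge0//.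
split; split.
- exact: (measurable_mexp hV mV a b).1.
- exists M; apply: filterS hM => w; apply: le_trans; apply: le_trans (h w).1 _; exact: ler_norm.
- exact: (measurable_mexp hV mV a b).2.
- exists M; apply: filterS hM => w; apply: le_trans; apply: le_trans (h w).2 _; exact: ler_norm.
Qed.

Lemma aebounded_mx_eigv V (T : R) : (forall w, hermmx (V w)) -> measurable_mx V ->
  {ae P, forall w, forall j, 0 <= eigv (V w) j <= T} -> aebounded_mx V.
Proof.
move=> hV mV hT a b.
have h w : (forall j, 0 <= eigv (V w) j <= T) ->
    `|Re (V w a b)| <= N%:R * T /\ `|Im (V w a b)| <= N%:R * T.
  move=> h; have [h1 h2] := funmx_entry_bound id (V w) a b.
  rewrite (funmx_id (hV w)) in h1 h2.
  have h3 : \sum_j `|eigv (V w) j| <= N%:R * T.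
    apply: (@le_trans _ _ (\sum_(j < N) T)).
      by apply: ler_sum => j _; have /andP[x0 xT] := h j; rewrite ger0_norm.
    by rewrite sumr_const card_ord mulr_natl.
  by split; [exact: le_trans h1 h3|exact: le_trans h2 h3].
split; split.
- exact: (mV a b).1.
- by exists (N%:R * T); apply: filterS hT => w /h [].
- exact: (mV a b).2.
- by exists (N%:R * T); apply: filterS hT => w /h [].
Qed.

End ExpectedMatrix.

(** * Independence of one summand from all earlier ones *)

Section PrefixIndependence.
Context d {Omega : measurableType d} {R : realType} (P : probability Omega R).
Variables (n : nat) (S : 'I_n -> set_system Omega).
Hypothesis S_sigma : forall i, sigma_algebra setT (S i).
Hypothesis S_meas : forall i, S i `<=` measurable.
Hypothesis S_ind : forall A : 'I_n -> set Omega, (forall i, S i (A i)) ->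
  P (\big[setI/setT]_(i < n) A i) = (\prod_(i < n) P (A i))%E.

(** A family stable under intersection that generates the sigma-algebra of the first [k] variables;
    the remaining factors are the whole space. *)
Definition prefix_rect (k : nat) : set_system Omega :=
  [set A | exists F : 'I_n -> set Omega, [/\ forall i, S i (F i),
    forall i : 'I_n, (k <= i)%N -> F i = setT & A = \big[setI/setT]_(i < n) F i]].

Lemma S_setT i : S i setT.
Proof. by have [S0 SC _] := S_sigma i; rewrite -(setD0 setT); exact: SC. Qed.

Lemma S_setI i A B : S i A -> S i B -> S i (A `&` B).
Proof.
have [_ _ _ h] := (sigma_algebraP (fun X _ => @subsetT _ X)).1 (S_sigma i).
exact: h.
Qed.

Lemma prefix_rect_setI k : setI_closed (prefix_rect k).
Proof.
move=> _ _ [F [SF Fk ->]] [G [SG Gk ->]].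
exists (fun i => F i `&` G i); split; last by rewrite big_split.
- by move=> i; exact: S_setI.
- by move=> i ki; rewrite Fk// Gk// setIid.
Qed.

Lemma prefix_rect_measurable k : prefix_rect k `<=` measurable.
Proof.
move=> _ [F [SF _ ->]]; elim/big_rec: _ => // i A _ mA.
by apply: measurableI => //; exact/S_meas/SF.
Qed.

Lemma prefix_rect_mem k (i : 'I_n) A : (i < k)%N -> S i A -> prefix_rect k A.
Proof.
move=> ik SA; exists (fun j => if j == i then A else setT); split.
- by move=> j; case: eqP => [->//|_]; exact: S_setT.
- by move=> j kj; case: eqP => // ji; move: kj; rewrite ji leqNgt ik.
- by rewrite -big_mkcond big_pred1_eq.
Qed.

Lemma prefix_indep (k : 'I_n) A B : <<s prefix_rect k >> A -> S k B ->
  P (A `&` B) = (P A * P B)%E.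
Proof.
move=> sA SB; apply: indep_sigma sA.
- exact: prefix_rect_measurable.
- exact: S_meas SB.
- exact: prefix_rect_setI.
- move=> _ [F [SF Fk ->]].
  (* The k-th factor of a prefix rectangle is the whole space, so [B] can take its place without
     changing the other factors. *)
  pose F' i := if i == k then B else F i.
  have -> : \big[setI/setT]_(i < n) F i `&` B = \big[setI/setT]_(i < n) F' i.
    rewrite (bigD1 k)//= [RHS](bigD1 k)//= Fk// setTI setIC /F' eqxx.
    by congr (_ `&` _); apply: eq_bigr => i /negbTE ->.
  rewrite !S_ind//; last first.
    by move=> i; rewrite /F'; case: eqP => [->|_].
  rewrite (bigD1 k)//= [in RHS](bigD1 k)//= /F' eqxx Fk// probability_setT mul1e muleC.
  by congr (_ * _)%E; apply: eq_bigr => i /negbTE ->.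
Qed.

End PrefixIndependence.

(** * The matrix Chernoff argument *)

Lemma big_ord_prefixS (V : nmodType) n (F : 'I_n -> V) (k : 'I_n) :
  \sum_(i < n | (i < k.+1)%N) F i = \sum_(i < n | (i < k)%N) F i + F k.
Proof.
rewrite (bigD1 k)//= addrC; congr (_ + _); apply: eq_bigl => i.
by rewrite ltnS ltn_neqAle val_eqE andbC.
Qed.

Section MatrixChernoff.
Context d {Omega : measurableType d} {R : realType} (P : probability Omega R).
Context {N : nat}.
Local Notation C := R[i].
Local Notation "x %:C" := (real_complex R x).
Local Notation Re := (@complex.Re R).
Local Notation Im := (@complex.Im R).
Local Notation E f := (\int[P]_w f w).
Variables (n : nat) (S : 'I_n -> set_system Omega).
Hypothesis S_sigma : forall i, sigma_algebra setT (S i).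
Hypothesis S_meas : forall i, S i `<=` measurable.
Hypothesis S_ind : forall A : 'I_n -> set Omega, (forall i, S i (A i)) ->
  P (\big[setI/setT]_(i < n) A i) = (\prod_(i < n) P (A i))%E.
Variables (T : R) (Y : 'I_n -> Omega -> 'M[C]_N).
Hypotheses (T0 : 0 < T) (hY : forall i w, hermmx (Y i w)).
Hypothesis mY : forall i, measurable_mx (Y i).
Hypothesis SY : forall i a b (B : set R), measurable B ->
  S i ((fun w => Re (Y i w a b)) @^-1` B) /\ S i ((fun w => Im (Y i w a b)) @^-1` B).
Hypothesis YT : forall i, {ae P, forall w, forall j, 0 <= eigv (Y i w) j <= T}.

Let prefix_sum k w := \sum_(i < n | (i < k)%N) Y i w.
Let prefix_esum k := \sum_(i < n | (i < k)%N) expect_mx P (Y i).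

Lemma hermmx_shifted (H : 'M[C]_N) (s : R) k w : hermmx H -> hermmx (H + s%:C *: prefix_sum k w).
Proof. by move=> hH; apply: hermmxD => //; apply: hermmxZ; apply: hermmx_sum. Qed.

Lemma measurable_shifted (H : 'M[C]_N) (s : R) k : measurable_mx (fun w => H + s%:C *: prefix_sum k w).
Proof.
apply: measurable_mxD; first exact: measurable_mx_cst.
by apply: measurable_mxZ; apply: measurable_mx_sum => i _.
Qed.

Lemma aebounded_Y i : aebounded_mx P (Y i).
Proof. exact: aebounded_mx_eigv (@hY i) (@mY i) (@YT i). Qed.

Lemma prefix_sumS (s : R) (H : 'M[C]_N) (k : 'I_n) w :
  H + s%:C *: prefix_sum k.+1 w = (H + s%:C *: prefix_sum k w) + s%:C *: Y k w.
Proof. by rewrite /prefix_sum big_ord_prefixS scalerDr addrA. Qed.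

Section Exponent.
Variables (s c : R).
(** [c] is the slope of the chord of e^(s x) over [0, T]. *)
Hypothesis cT : c * T = expR (s * T) - 1.

Lemma rtr_mexp_shift_le (A X : 'M[C]_N) : hermmx A -> hermmx X ->
  (forall j, 0 <= eigv X j <= T) ->
  rtr (mexp (A + s%:C *: X)) <= rtr (mexp A) + c * rtr (mexp A *m X).
Proof.
move=> hA hX XT; have := rtr_mexp_shift (ltW T0) hX XT s hA.
rewrite -cT mulrAC (mulrC _ T) ler_pM2l//.
move: (rtr _) (rtr _) (rtr _) => u v z; lra.
Qed.

(** Since 0 <= tr (e^W X) <= T tr e^W, the shift inequality shows that each further summand
    multiplies the almost sure bound by at most 1 + |c| T. *)
Lemma aebounded_rtr_mexp (H : 'M[C]_N) k : hermmx H -> (k <= n)%N ->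
  aebounded P (fun w => rtr (mexp (H + s%:C *: prefix_sum k w))).
Proof.
move=> hH; elim: k => [|k IH] kn.
  rewrite (_ : (fun w => _) = (fun=> rtr (mexp H))); first exact: aebounded_cst.
  by apply/funext => w; rewrite /prefix_sum big_pred0// scaler0 addr0.
have [_ [M hM]] := IH (ltnW kn).
split.
  apply: measurable_rtr; apply: measurable_mexp; last exact: measurable_shifted.
  by move=> w; exact: hermmx_shifted.
exists ((1 + `|c| * T) * M).
apply: ae_imp2 hM (YT (Ordinal kn)) => w hM XT.
rewrite ger0_norm ?rtr_mexp_ge0// in hM; rewrite ger0_norm ?rtr_mexp_ge0//.
rewrite (prefix_sumS s H (Ordinal kn)) /=.
have hW := hermmx_shifted s k w hH.
apply: le_trans (rtr_mexp_shift_le hW (hY _ _) XT) _.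
have := rtr_mexpM_le (hY (Ordinal kn) w) XT (H + s%:C *: prefix_sum k w).
have := rtr_mexpM_ge0 (hY (Ordinal kn) w) XT (H + s%:C *: prefix_sum k w).
move: (rtr_mexp_ge0 (H + s%:C *: prefix_sum k w)) hM.
move: (rtr (mexp _)) (rtr (_ *m _)) => f g f0 fM g0 gf.
have h1 : c * g <= `|c| * (T * f).
  apply: (@le_trans _ _ (`|c| * g)); first by rewrite ler_wpM2r// ler_norm.
  by rewrite ler_wpM2l.
apply: (@le_trans _ _ ((1 + `|c| * T) * f)); first by rewrite mulrDl mul1r lerD2l -mulrA.
by rewrite ler_wpM2l// addr_ge0// mulr_ge0// ltW.
Qed.

Lemma measurable_shifted_prefix (H : 'M[C]_N) k :
  @measurable_mx _ (g_sigma_algebraType (prefix_rect S k)) R N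
    (fun w => H + s%:C *: prefix_sum k w).
Proof.
apply: measurable_mxD; first exact: measurable_mx_cst.
apply: measurable_mxZ; apply: measurable_mx_sum => i ik a b.
by split=> _ B mB; rewrite setTI; apply: sub_sigma_algebra;
  apply: (prefix_rect_mem S_sigma ik); [exact: (SY i a b mB).1|exact: (SY i a b mB).2].
Qed.

(** The exponential is measurable for the sigma-algebra of the first [k] variables, hence
    independent of [Y k]. *)
Lemma Rexp_rtr_prefix (H : 'M[C]_N) (k : 'I_n) : hermmx H ->
  E (fun w => rtr (mexp (H + s%:C *: prefix_sum k w) *m Y k w)) =
  E (fun w => rtr (mexp (H + s%:C *: prefix_sum k w) *m expect_mx P (Y k))).
Proof.
move=> hH; have hW w := hermmx_shifted s k w hH.
have mW := @measurable_mexp _ (g_sigma_algebraType (prefix_rect S k)) R N _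
  hW (measurable_shifted_prefix H k).
have aW : aebounded_mx P (fun w => mexp (H + s%:C *: prefix_sum k w)).
  apply: aebounded_mexp => //; first exact: measurable_shifted.
  exact: aebounded_rtr_mexp (ltnW (ltn_ord k)).
apply: (Rexp_rtrM_indep aW (@aebounded_Y k)) => a b a' b' A B mA mB.
  apply: (prefix_indep S_sigma S_meas S_ind (k := k)); last exact: (SY _ _ _ mB).1.
  by have := (mW a b).1 measurableT _ mA; rewrite setTI.
apply: (prefix_indep S_sigma S_meas S_ind (k := k)); last exact: (SY _ _ _ mB).2.
by have := (mW a b).2 measurableT _ mA; rewrite setTI.
Qed.

(** The summands are replaced by their means from the last to the first. The deterministic matrix
    [H] collects the means already substituted, which is why the induction is over all [H]. *)
Lemma Rexp_rtr_mexp_le (H : 'M[C]_N) k : hermmx H -> (k <= n)%N ->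
  E (fun w => rtr (mexp (H + s%:C *: prefix_sum k w))) <= rtr (mexp (H + c%:C *: prefix_esum k)).
Proof.
elim: k H => [|k IH] H hH kn.
  rewrite /prefix_esum big_pred0// scaler0 addr0.
  rewrite (_ : (fun w => _) = (fun=> rtr (mexp H))); first by rewrite Rexp_cst.
  by apply/funext => w; rewrite /prefix_sum big_pred0// scaler0 addr0.
pose o := Ordinal kn; pose M := expect_mx P (Y o).
have hM : hermmx M by apply: hermmx_expect; [exact: aebounded_Y|exact: hY].
have hW w := hermmx_shifted s k w hH.
have hH' : hermmx (H + c%:C *: M) by apply/hermmxD/hermmxZ.
have aW := aebounded_rtr_mexp hH (ltnW kn).
have aWm : aebounded_mx P (fun w => mexp (H + s%:C *: prefix_sum k w)).
  by apply: aebounded_mexp => //; exact: measurable_shifted.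
have aWY := aebounded_rtrM aWm (@aebounded_Y o).
have aWM := aebounded_rtrM aWm (aebounded_mx_cst P M).
(* The shift inequality makes the last summand appear linearly, and only then can independence
   replace it by its mean. *)
apply: (@le_trans _ _ (E (fun w => rtr (mexp (H + s%:C *: prefix_sum k w)) +
    c * rtr (mexp (H + s%:C *: prefix_sum k w) *m Y o w)))).
  apply: Rexp_le; [exact: aebounded_rtr_mexp|by apply: aeboundedD => //; exact: aeboundedZ|].
  apply: filterS (YT o) => w XT; rewrite (prefix_sumS s H o) /=.
  exact: rtr_mexp_shift_le.
rewrite RexpD//; last exact: aeboundedZ.
rewrite RexpZ// (Rexp_rtr_prefix o hH) -RexpZ// -RexpD//; last exact: aeboundedZ.
have -> : H + c%:C *: prefix_esum k.+1 = H + c%:C *: M + c%:C *: prefix_esum k.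
  by rewrite /prefix_esum (big_ord_prefixS _ o) scalerDr -addrA [in RHS](addrC (c%:C *: M)).
apply: le_trans (IH _ hH' (ltnW kn)).
apply: Rexp_le.
- by apply: aeboundedD => //; exact: aeboundedZ.
- exact: aebounded_rtr_mexp (ltnW kn).
(* Klein's inequality puts the mean back into the exponent, where it joins [H]. *)
- apply: aeW => w.
  have -> : H + c%:C *: M + s%:C *: prefix_sum k w = (H + s%:C *: prefix_sum k w) + c%:C *: M.
    by rewrite addrAC.
  have h2 : hermmx (H + s%:C *: prefix_sum k w + c%:C *: M) by apply/hermmxD/hermmxZ.
  have := klein (hW w) h2; rewrite (addrC (H + _)) addrK rtrMZ.
  by rewrite (addrC (c%:C *: M)).
Qed.

Let total w := \sum_(i < n) Y i w.
Let etotal := \sum_(i < n) expect_mx P (Y i).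

Lemma prefix_sum_total w : prefix_sum n w = total w.
Proof. by apply: eq_bigl => i; rewrite ltn_ord. Qed.

Lemma total_shifted : (fun w => rtr (mexp (s%:C *: total w))) =
  (fun w => rtr (mexp (0 + s%:C *: prefix_sum n w))).
Proof. by apply/funext => w; rewrite prefix_sum_total add0r. Qed.

Lemma Rexp_rtr_mexp_total :
  E (fun w => rtr (mexp (s%:C *: total w))) <= rtr (mexp (c%:C *: etotal)).
Proof.
have -> : etotal = prefix_esum n by rewrite /prefix_esum; apply: eq_bigl => i; rewrite ltn_ord.
rewrite total_shifted -[X in mexp X](add0r (c%:C *: prefix_esum n)).
exact: Rexp_rtr_mexp_le (@hermmx0 R N) (leqnn n).
Qed.

(** On [A] one eigenvalue already gives e^a <= tr e^(s total); Markov's inequality and the bound on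
    the mean trace finish. The event is phrased through s t so that negative [s] covers the lower
    tail. *)
Lemma matrix_laplace (a K : R) (A : set Omega) : measurable A ->
  (forall w, A w -> exists2 t, eigenvalue (total w) t%:C & a <= s * t) ->
  (forall t, eigenvalue etotal t%:C -> expR (c * t) <= K) ->
  (P A <= (expR (- a) * (N%:R * K))%:E)%E.
Proof.
move=> mA hA hK.
have hT w : hermmx (total w) by exact: hermmx_sum.
have hE : hermmx etotal.
  by apply: hermmx_sum => i; apply: hermmx_expect; [exact: aebounded_Y|exact: hY].
have aT : aebounded P (fun w => rtr (mexp (s%:C *: total w))).
  by rewrite total_shifted; exact: aebounded_rtr_mexp (@hermmx0 R N) (leqnn n).
have mB : measurable [set w | expR a <= rtr (mexp (s%:C *: total w))].
  have := measurable_fun_ler (measurable_cst (expR a)) aT.1.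
  by move=> /(_ measurableT [set true]); rewrite setTI; exact.
have AB : A `<=` [set w | expR a <= rtr (mexp (s%:C *: total w))].
  move=> w /hA[t et at_] /=; apply: le_trans (expR_eigenvalue_le s (hT w) et).
  by rewrite ler_expR.
apply: (@le_trans _ _ (P [set w | expR a <= rtr (mexp (s%:C *: total w))])).
  by apply: le_measure => //; rewrite inE.
have := Rexp_markov aT (fun w => rtr_mexp_ge0 _) mB.
have : E (fun w => rtr (mexp (s%:C *: total w))) <= N%:R * K.
  apply: le_trans Rexp_rtr_mexp_total _; apply: rtr_mexp_le => // j.
  exact/hK/eigenvalue_eigv.
rewrite -lee_fin => h1 h2; have := le_trans h2 h1.
rewrite -(@lee_pmul2l _ (expR (- a))%:E) ?lte_fin ?expR_gt0//.
by rewrite muleA -EFinM -expRD addNr expR0 mul1e -EFinM.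
Qed.

End Exponent.
End MatrixChernoff.

(** * Block circulant matrices of tensors *)

(** This is -(i - j) = j - i modulo p; with truncated subtraction the cases differ in whether i + p
    - j reaches p. *)
Lemma modn_sub_opp (p i j : nat) : (i < p)%N -> (j < p)%N ->
  ((p - (i + p - j) %% p) %% p = (j + p - i) %% p)%N.
Proof.
move=> ip jp; have [ij|ij] := ltnP i j.
  have e1 : (i + p - j < p)%N by lia.
  have e2 : (p - (i + p - j) = j - i)%N by lia.
  have e3 : (j + p - i = (j - i) + p)%N by lia.
  by rewrite (modn_small e1) e2 e3 modnDr.
have e1 : (i + p - j = (i - j) + p)%N by lia.
have e2 : (i - j < p)%N by lia.
have e3 : (p - (i - j) = j + p - i)%N by lia.
by rewrite e1 modnDr (modn_small e2) e3.
Qed.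

Section BlockCirculant.
Context {R : realType} {m p : nat}.
Implicit Types A : tensor R m m p.

Lemma bcircE A i j : bcirc A i j =
  A (circ_idx (tagnat.sig1 i) (tagnat.sig1 j)) (tagnat.sig2 i) (tagnat.sig2 j).
Proof. by rewrite mxE. Qed.

Lemma bcirc_sum (I : Type) (r : seq I) (F : I -> tensor R m m p) :
  bcirc (\sum_(i <- r) F i) = \sum_(i <- r) bcirc (F i).
Proof.
apply/matrixP => i j; rewrite bcircE sum_ffunE !summxE.
by apply: eq_bigr => k _; rewrite bcircE.
Qed.

Lemma circ_idx_opp (i j : 'I_p) :
  circ_idx (Ordinal (ord_pos (circ_idx i j))) (circ_idx i j) = circ_idx j i.
Proof.
by apply/val_inj; rewrite /= add0n modn_sub_opp ?ltn_ord.
Qed.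

(** The slice reversal in [tH] is the exchange of block row and block column, by [circ_idx_opp]. *)
Lemma hermmx_bcirc A : hermitian_tensor A -> hermmx (bcirc A).
Proof.
move=> hA; apply/matrixP => i j; rewrite mxE !bcircE.
rewrite -[in RHS]hA ffunE mxE circ_idx_opp.
by [].
Qed.

End BlockCirculant.

(** * Random tensors as random block circulant matrices *)

Section RandomBlocks.
Context {d : measure_display} {Omega : measurableType d} {R : realType}
  (P : probability Omega R).
Variables (m p : nat).

Lemma bcirc_expect (X : Omega -> tensor R m m p) :
  bcirc (texpect P X) = expect_mx P (fun w => bcirc (X w)).
Proof.
apply/matrixP => i j; rewrite bcircE ffunE !mxE /cexpect /Rintegral unlock.
congr Complex; congr fine; apply: eq_integral => w _; rewrite bcircE //.
Qed.

Lemma measurable_bcirc (X : Omega -> tensor R m m p) : random_tensor X ->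
  measurable_mx (fun w => bcirc (X w)).
Proof.
move=> mX a b; split; under eq_fun do rewrite bcircE.
  exact: (mX _ _ _).1.
exact: (mX _ _ _).2.
Qed.

Lemma tensor_sigma_measurable (X : Omega -> tensor R m m p) : random_tensor X ->
  tensor_sigma X `<=` measurable.
Proof.
move=> mX; apply: smallest_sub; first exact: sigma_algebra_measurable.
move=> _ [k [a [b [B [mB [] ->]]]]]; rewrite -[X in measurable X]setTI.
  exact: (mX k a b).1.
exact: (mX k a b).2.
Qed.

Lemma tensor_sigma_bcirc (X : Omega -> tensor R m m p) a b (B : set R) : measurable B ->
  tensor_sigma X ((fun w => complex.Re (bcirc (X w) a b)) @^-1` B) /\
  tensor_sigma X ((fun w => complex.Im (bcirc (X w) a b)) @^-1` B).
Proof.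
move=> mB; split; apply: sub_sigma_algebra.
  rewrite (_ : (fun w => complex.Re (bcirc (X w) a b)) =
    (fun w => complex.Re (X w (circ_idx (tagnat.sig1 a) (tagnat.sig1 b))
      (tagnat.sig2 a) (tagnat.sig2 b)))).
    by do 3 eexists; exists B; split => //; left.
  by apply/funext => w; rewrite bcircE.
rewrite (_ : (fun w => complex.Im (bcirc (X w) a b)) =
    (fun w => complex.Im (X w (circ_idx (tagnat.sig1 a) (tagnat.sig1 b))
      (tagnat.sig2 a) (tagnat.sig2 b)))).
  by do 3 eexists; exists B; split => //; right.
by apply/funext => w; rewrite bcircE.
Qed.

Lemma eigv_bcirc (A : tensor R m m p) (T : R) : hermitian_tensor A -> tle 0 A ->
  tlmax A <= T -> forall j, 0 <= eigv (bcirc A) j <= T.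
Proof.
move=> hA; rewrite /tle subr0 => psdA lT j.
by rewrite psd_eigv_ge0//= (le_trans _ lT)//; apply: eigv_le_mxlmax; exact: hermmx_bcirc.
Qed.

Lemma tlmaxE (A : tensor R m m p) : tlmax A = mxlmax (bcirc A).
Proof. by []. Qed.

Lemma tlminE (A : tensor R m m p) : tlmin A = mxlmin (bcirc A).
Proof. by []. Qed.

(** Serves both tails, with u = 1 + theta or u = 1 - theta. *)
Lemma chernoff_rate (u r : R) : 0 < u ->
  (expR (u - 1) / u `^ u) `^ r = expR ((u - 1 - u * ln u) * r).
Proof.
move=> u0; rewrite expRM; congr (_ `^ _).
by rewrite /powR gt_eqF// -expRN -expRD.
Qed.

(** Needed for the lower tail at theta = 1, where the optimal [s] would be minus infinity: the
    bounds at e^(sT) = 1 / (k + 1) pass to the limit. *)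
Lemma chernoff_limit (r a b T : R) :
  (forall k : nat, r <= a * expR ((k.+1%:R^-1 - 1) / T * b)) -> r <= a * expR (- (b / T)).
Proof.
move=> h; have -> : - (b / T) = (0 - 1) / T * b by rewrite sub0r !mulNr mul1r mulrC.
suff cf : (fun k : nat => a * expR ((k.+1%:R^-1 - 1) / T * b)) @ \oo -->
    a * expR ((0 - 1) / T * b) by apply: (cvgr_to_ge cf); exact: nearW.
apply: cvgMr; apply: continuous_cvg; first exact: continuous_expR.
by apply: cvgMl; apply: cvgMl; apply: cvgB; [exact: cvg_harmonic|exact: cvg_cst].
Qed.

End RandomBlocks.

(** * The two tail bounds for tensors *)

Theorem theorem4 (d : measure_display) (Omega : measurableType d) (R : realType)
  (P : probability Omega R) (m p n : nat) (T : R)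
  (X : 'I_n -> Omega -> tensor R m m p) :
  (0 < m)%N -> (0 < p)%N -> (0 < n)%N -> 0 < T ->
  (forall i, random_tensor (X i)) ->
  (forall i w, hermitian_tensor (X i w)) ->
  tindependent P X ->
  (forall i, {ae P, forall w, tle 0 (X i w) /\ tlmax (X i w) <= T}) ->
  let mu_max := tlmax (\sum_(i < n) texpect P (X i)) in
  let mu_min := tlmin (\sum_(i < n) texpect P (X i)) in
  (forall theta : R, 0 <= theta ->
     (P [set w | ((1 + theta) * mu_max <= tlmax (\sum_(i < n) X i w))%R]
      <= ((m * p)%:R * (expR theta / (1 + theta) `^ (1 + theta)) `^ (mu_max / T))%:E)%E) /\
  (forall theta : R, 0 <= theta <= 1 ->
     (P [set w | (tlmin (\sum_(i < n) X i w) <= (1 - theta) * mu_min)%R]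
      <= ((m * p)%:R * (expR (- theta) / (1 - theta) `^ (1 - theta)) `^ (mu_min / T))%:E)%E).
Proof.
move=> m0 p0 n0 T0 mX hX iX XT mu_max mu_min.
(* A block matrix has this sum as its size by construction; the product [m * p] is only equal to
   it. *)
pose N := (\sum_(i < p) m)%N.
have NE : N = (m * p)%N by rewrite /N sum_nat_const card_ord mulnC.
have N0 : (0 < N)%N by rewrite NE muln_gt0 m0.
pose Y i w := bcirc (X i w).
pose M := \sum_(i < n) expect_mx P (Y i).
pose Z w := \sum_(i < n) Y i w.
have hY i w : hermmx (Y i w) by apply: hermmx_bcirc.
have mY i : measurable_mx (Y i) by apply: measurable_bcirc.
have YT i : {ae P, forall w, forall j, 0 <= eigv (Y i w) j <= T}.
  by apply: filterS (XT i) => w [h1 h2]; exact: eigv_bcirc.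
have hM : hermmx M.
  apply: hermmx_sum => i; apply: hermmx_expect => //.
  exact: aebounded_mx_eigv (hY i) (mY i) (YT i).
have hZ w : hermmx (Z w) by exact: hermmx_sum.
have mZ : measurable_mx Z by apply: measurable_mx_sum => i _.
have muE : mu_max = mxlmax M /\ mu_min = mxlmin M.
  have e : bcirc (\sum_(i < n) texpect P (X i)) = M.
    by rewrite bcirc_sum; apply: eq_bigr => i _; rewrite bcirc_expect.
  by rewrite /mu_max /mu_min tlmaxE tlminE e; split.
have ZE w : tlmax (\sum_(i < n) X i w) = mxlmax (Z w) /\
            tlmin (\sum_(i < n) X i w) = mxlmin (Z w).
  have e : bcirc (\sum_(i < n) X i w) = Z w by exact: bcirc_sum.
  by rewrite tlmaxE tlminE e; split.
have laplace := @matrix_laplace d Omega R P N n (fun i => tensor_sigma (X i))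
  (fun i => smallest_sigma_algebra _ _)
  (fun i => tensor_sigma_measurable (mX i)) iX T Y T0 hY mY
  (fun i a b B mB => tensor_sigma_bcirc (X i) a b mB) YT.
have emax w : eigenvalue (Z w) (real_complex R (mxlmax (Z w))) by exact: eigenvalue_mxlmax.
have emin w : eigenvalue (Z w) (real_complex R (mxlmin (Z w))) by exact: eigenvalue_mxlmin.
have mmax a : measurable [set w | a <= mxlmax (Z w)].
  have := measurable_fun_ler (measurable_cst a) (measurable_mxlmax N0 hZ mZ).
  by move=> /(_ measurableT [set true]); rewrite setTI; exact.
have mmin a : measurable [set w | mxlmin (Z w) <= a].
  have := measurable_fun_ler (measurable_mxlmin N0 hZ mZ) (measurable_cst a).
  by move=> /(_ measurableT [set true]); rewrite setTI; exact.
have eM t : eigenvalue M (real_complex R t) -> mxlmin M <= t <= mxlmax M.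
  by move=> /(eigenvalueE hM)[j ->]; rewrite mxlmin_le_eigv ?eigv_le_mxlmax.
rewrite -NE muE.1 muE.2; split => theta.
- move=> th0; have u0 : 0 < 1 + theta by rewrite (lt_le_trans ltr01)// lerDl.
  rewrite (_ : [set w | _] = [set w | (1 + theta) * mxlmax M <= mxlmax (Z w)]); last first.
    by apply/seteqP; split=> w /=; rewrite (ZE w).1.
  have lnu : 0 <= ln (1 + theta) by rewrite ln_ge0// lerDl.
  have e1 : 1 + theta - 1 = theta by rewrite addrAC subrr add0r.
  (* The optimal choice is e^(sT) = 1 + theta, giving c = theta / T. As c >= 0, the largest
     eigenvalue of the mean controls the trace. *)
  apply: le_trans (@laplace (ln (1 + theta) / T) (theta / T) _
    (ln (1 + theta) / T * ((1 + theta) * mxlmax M)) (expR (theta / T * mxlmax M))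
    _ (mmax _) _ _) _.
  + by rewrite !divfK ?gt_eqF// lnK ?posrE// e1.
  + move=> w /= h; exists (mxlmax (Z w)); first exact: emax.
    by rewrite ler_wpM2l// divr_ge0// ltW.
  + move=> t /eM/andP[_ h]; rewrite ler_expR ler_wpM2l// divr_ge0// ltW//.
  + rewrite lee_fin mulrCA -expRD.
    have := chernoff_rate (mxlmax M / T) u0; rewrite e1 => ->.
    rewrite le_eqVlt; apply/orP; left; apply/eqP; congr (_ * expR _).
    by field; rewrite gt_eqF.
- move=> /andP[th0]; rewrite le_eqVlt => /orP[/eqP ->|th1].
    (* At theta = 1 the denominator is 0^0 = 1, and the bound to prove is N e^(-mu_min / T). *)
    rewrite subrr mul0r powRr0 divr1 -expRM mulN1r.
    rewrite (_ : [set w | _] = [set w | mxlmin (Z w) <= 0]); last first.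
      by apply/seteqP; split=> w /=; rewrite (ZE w).2.
    have h k := @laplace (ln k.+1%:R^-1 / T) ((k.+1%:R^-1 - 1) / T).
    have mm := mmin 0; move: mm h; set A := [set w | _] => mm h.
    have [r er] : exists r, P A = r%:E.
      by exists (fine (P A)); rewrite fineK// fin_num_measure.
    rewrite er lee_fin; apply: chernoff_limit => k.
    have k1 : k.+1%:R^-1 <= 1 :> R by rewrite invf_le1 ?ltr0n// ler1n.
    (* The threshold is a = 0: on the event the smallest eigenvalue is nonpositive and so is [s],
       hence their product is nonnegative. *)
    have := h k _ 0 (expR ((k.+1%:R^-1 - 1) / T * mxlmin M)) A mm.
    rewrite er lee_fin oppr0 expR0 mul1r; apply.
    + by rewrite !divfK ?gt_eqF// lnK ?posrE ?invr_gt0 ?ltr0n.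
    + move=> w /= hw; exists (mxlmin (Z w)); first exact: emin.
      by rewrite mulr_le0// ler_pdivrMr// mul0r ln_le0.
    + move=> t /eM/andP[ht _]; rewrite ler_expR ler_wnM2l//.
      by rewrite ler_pdivrMr// mul0r subr_le0.
  have u0 : 0 < 1 - theta by rewrite subr_gt0.
  rewrite (_ : [set w | _] = [set w | mxlmin (Z w) <= (1 - theta) * mxlmin M]); last first.
    by apply/seteqP; split=> w /=; rewrite (ZE w).2.
  have lnu : ln (1 - theta) <= 0 by rewrite ln_le0// gerBl.
  have s0 : ln (1 - theta) / T <= 0 by rewrite ler_pdivrMr// mul0r.
  have c0 : - theta / T <= 0 by rewrite ler_pdivrMr// mul0r oppr_le0.
  have e1 : 1 - theta - 1 = - theta by rewrite addrAC subrr sub0r.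
  (* Now e^(sT) = 1 - theta and c = - theta / T. Both [s] and [c] are nonpositive, so they reverse
     inequalities and the smallest eigenvalues take over. *)
  apply: le_trans (@laplace (ln (1 - theta) / T) (- theta / T) _
    (ln (1 - theta) / T * ((1 - theta) * mxlmin M)) (expR (- theta / T * mxlmin M))
    _ (mmin _) _ _) _.
  + by rewrite !divfK ?gt_eqF// lnK ?posrE// e1.
  + move=> w /= h; exists (mxlmin (Z w)); first exact: emin.
    by rewrite ler_wnM2l.
  + by move=> t /eM/andP[h _]; rewrite ler_expR ler_wnM2l.
  + rewrite lee_fin mulrCA -expRD.
    have := chernoff_rate (mxlmin M / T) u0; rewrite e1 => ->.
    rewrite le_eqVlt; apply/orP; left; apply/eqP; congr (_ * expR _).
    by field; rewrite gt_eqF.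
Qed.
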